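(* Let $p,q\ge 2$ and let $M$ be a manifold of dimension $pq$ carrying an almost Grassmann structure $AG(p-1,p+q-1)$, with structure functions $a=\{a^{i\beta\gamma}_{\alpha jk}\}$, $b^1=\{b^{i\gamma\delta}_{jkl}\}$, $b^2=\{b^{\beta\gamma\delta}_{\alpha kl}\}$, $c=\{c^{\alpha\beta\gamma}_{ijk}\}$. If $p>2$, then the components of $c$ are expressed in terms of the components of the subobject $(a,b^2)$ and their Pfaffian derivatives. If $q>2$, then the components of $c$ are expressed in terms of the components of the subobject $(a,b^1)$ and their Pfaffian derivatives. Here ''expressed in terms of'' means given by universal formulas, the same for all such structures with given $p,q$.
   Context: Index ranges: $\alpha,\beta,\ldots=1,\dots,p$; $i,j,\ldots=p+1,\dots,p+q$; summation over repeated indices; everything real and smooth. Almost Grassmann structure: for $\dim M=pq$, an almost Grassmann structure $AG(p-1,p+q-1)$ is a smooth field of Segre cones $SC_x(p,q)\subset T_x(M)$. That is, locally there are smooth (adapted) frames $\{e_i^\alpha\}$ with dual coframe $\omega_\alpha^i$ such that $SC_x(p,q)=\{z=z^i_\alpha e_i^\alpha:\ z^i_\alpha=t_\alpha s^i \text{ for some } t_\alpha,s^i\}$. Adapted frames are related by $'e_i^\alpha=A_\beta^\alpha A_i^je_j^\beta$ with nonsingular matrices $(A^\alpha_\beta)$, $(A_i^j)$, giving the structure group $G=\mathbf{SL}(p)\times\mathbf{SL}(q)\times\mathbf{H}$, where $\mathbf{H}$ is the group of homotheties. Structure equations: the specialized (reduced) higher-order frames of the structure form a bundle over $M$ of dimension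 $2pq+p^2+q^2-1$. It carries the basis forms $\omega_\alpha^i$ (coframe forms of adapted frames), together with fiber 1-forms $\omega_\alpha^\beta,\ \omega_j^i$ (with $\omega_\gamma^\gamma=0$, $\omega_k^k=0$), $\omega$, and $\omega_i^\alpha$. All these forms together span the cotangent spaces and are independent apart from the two trace conditions. They satisfy $$d\omega_\alpha^i-\omega_\alpha^j\wedge\omega_j^i-\omega_\alpha^\beta\wedge\omega_\beta^i-\omega\wedge\omega_\alpha^i=a^{i\beta\gamma}_{\alpha jk}\,\omega_\beta^j\wedge\omega_\gamma^k,$$ $$d\omega_\alpha^\beta-\omega_\alpha^\gamma\wedge\omega_\gamma^\beta=\tfrac{q}{p+q}\bigl(\delta_\alpha^\beta\,\omega_\gamma^k\wedge\omega_k^\gamma-p\,\omega_\alpha^k\wedge\omega_k^\beta\bigr)+b^{\beta\gamma\delta}_{\alpha kl}\,\omega_\gamma^k\wedge\omega_\delta^l,$$ $$d\omega_j^i-\omega_j^k\wedge\omega_k^i=\tfrac{p}{p+q}\bigl(\delta_j^i\,\omega_k^\gamma\wedge\omega_\gamma^k-q\,\omega_j^\gamma\wedge\omega_\gamma^i\bigr)+b^{i\gamma\delta}_{jkl}\,\omega_\gamma^k\wedge\omega_\delta^l,$$ $$d\omega=\omega_i^\alpha\wedge\omega_\alpha^i,$$ $$d\omega_i^\alpha-\omega_i^\beta\wedge\omega_\beta^\alpha-\omega_i^j\wedge\omega_j^\alpha+\omega\wedge\omega_i^\alpha=c^{\alpha\beta\gamma}_{ijk}\,\omega_\gamma^k\wedge\omega_\beta^j-a^{k\alpha\beta}_{\gamma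 ij}\,\omega_k^\gamma\wedge\omega_\beta^j.$$ The specialization of frames is characterized by the following conditions on the structure functions: - $a^{i\beta\gamma}_{\alpha jk}=-a^{i\gamma\beta}_{\alpha kj}$, $a^{i\alpha\gamma}_{\alpha jk}=0$, $a^{i\beta\gamma}_{\alpha ik}=0$; - $b^{\beta\gamma\delta}_{\alpha kl}=-b^{\beta\delta\gamma}_{\alpha lk}$, $b^{i\gamma\delta}_{jkl}=-b^{i\delta\gamma}_{jlk}$, $b^{\alpha\gamma\delta}_{\alpha kl}=0$, $b^{i\gamma\delta}_{ikl}=0$; - $b^{\gamma\alpha\delta}_{\alpha kl}-b^{i\gamma\delta}_{kil}+b^{\delta\alpha\gamma}_{\alpha lk}-b^{i\delta\gamma}_{lik}=0$; - $c^{\alpha\beta\gamma}_{ijk}=-c^{\alpha\gamma\beta}_{ikj}$, and the alternation of $c^{\alpha\beta\gamma}_{ijk}$ over the three index pairs $(\alpha,i),(\beta,j),(\gamma,k)$ vanishes. Pfaffian derivatives: the Pfaffian derivatives of a function $f$ on this bundle with respect to the basis forms are the coefficients of the forms $\omega_\varepsilon^m$ in the expansion of $df$ in the forms $\omega_\alpha^i$, $\omega_\alpha^\beta$, $\omega_j^i$, $\omega$, $\omega_i^\alpha$. *)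

(* Defs.v *)
From HB Require Import structures.
From mathcomp Require Import all_boot all_order all_algebra.
From mathcomp Require Import all_classical all_reals all_analysis.

Set Implicit Arguments.
Unset Strict Implicit.
Unset Printing Implicit Defensive.

Import Order.TTheory GRing.Theory Num.Theory.
Import numFieldNormedType.Exports.
Local Open Scope classical_set_scope.
Local Open Scope ring_scope.

(* C^k (all partial derivatives up to order k exist and are continuous) on a
   set U, which is open in every use below. *)
Fixpoint Ck (R : realType) (n k : nat) (U : set 'rV[R]_n)
    (f : 'rV[R]_n -> R) {struct k} : Prop :=
  (forall x, U x -> {for x, continuous f}) /\
  if k is k'.+1 then
    forall i : 'I_n, (forall x, U x -> derivable f x (delta_mx 0 i)) /\
                     Ck k' U ('D_(delta_mx 0 i) f)
  else True.

Definition smooth_on (R : realType) (n : nat) (U : set 'rV[R]_n)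
    (f : 'rV[R]_n -> R) : Prop := forall k, Ck k U f.

Record chart (R : realType) (n : nat) (T : Type) := Chart {
  cdom : set T;
  cmap : T -> 'rV[R]_n;
  cinv : 'rV[R]_n -> T }.

Definition is_chart (R : realType) (n : nat) (T : topologicalType)
    (c : chart R n T) : Prop :=
  [/\ open (cdom c) /\ open (cmap c @` cdom c),
      (forall x, cdom c x -> cinv c (cmap c x) = x),
      (forall x, cdom c x -> {for x, continuous (cmap c)}) &
      (forall y, (cmap c @` cdom c) y -> {for y, continuous (cinv c)})].

Definition local_rep (R : realType) (m n : nat) (T U : Type)
    (c : chart R m T) (d : chart R n U) (f : T -> U) (y : 'rV[R]_m) :
    'rV[R]_n := cmap d (f (cinv c y)).

Record manifold (R : realType) (n : nat) := Manifold {
  carrier :> topologicalType;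
  atlas : set (chart R n carrier);
  mfd_hausdorff : hausdorff_space carrier;
  mfd_countable : @second_countable carrier;
  mfd_chart : forall c, atlas c -> is_chart c;
  mfd_cover : forall x : carrier, exists2 c, atlas c & cdom c x;
  mfd_compat : forall c d, atlas c -> atlas d -> forall k : 'I_n,
    smooth_on (cmap c @` (cdom c `&` cdom d))
              (fun y => local_rep c d id y 0 k) }.
Arguments atlas {R n} M _ : rename.

(* Tangent vectors are handled through their components in a chart, as row
   vectors; the differential of f sends v to v *m tmap c d f x. *)
Definition tmap (R : realType) (m n : nat) (T U : Type)
    (c : chart R m T) (d : chart R n U) (f : T -> U) (x : T) : 'M[R]_(m, n) :=
  jacobian (local_rep c d f) (cmap c x).

Definition smooth_fun (R : realType) (n : nat) (M : manifold R n)
    (f : M -> R) : Prop :=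
  forall c, atlas M c -> smooth_on (cmap c @` cdom c) (f \o cinv c).

Definition smooth_map_on (R : realType) (m n : nat) (M : manifold R m)
    (N : manifold R n) (V : set M) (f : M -> N) : Prop :=
  (forall x, V x -> {for x, continuous f}) /\
  forall c d, atlas M c -> atlas N d -> forall k : 'I_n,
    smooth_on (cmap c @` (cdom c `&` V `&` (f @^-1` cdom d)))
              (fun y => local_rep c d f y 0 k).

(* Local triviality asks for psi such that (proj, psi) is a diffeomorphism
   of proj^-1(V) onto V x F, i.e. a smooth bijective immersion between
   manifolds of equal dimension. *)
Definition fiber_bundle (R : realType) (m n : nat) (B : manifold R m)
    (M : manifold R n) (proj : B -> M) : Prop :=
  [/\ smooth_map_on setT proj,
      (forall x, exists u, proj u = x) &
      exists F : manifold R (m - n), forall x : M,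
        exists (V : set M) (psi : B -> F),
        [/\ open V /\ V x,
            smooth_map_on (proj @^-1` V) psi,
            set_bij (proj @^-1` V) (V `*` setT) (fun u => (proj u, psi u)) &
            forall b c d u, atlas B b -> atlas M c -> atlas F d ->
              V (proj u) -> cdom b u -> cdom c (proj u) -> cdom d (psi u) ->
              forall v : 'rV[R]_m, v *m tmap b c proj u = 0 ->
                v *m tmap b d psi u = 0 -> v = 0]].

(* A 1-form is given by its components in every chart, as a column vector:
   the value of w on the tangent vector v is v *m w c x. *)
Definition form1 (R : realType) (n : nat) (M : manifold R n) : Type :=
  chart R n M -> M -> 'cV[R]_n.

Definition smooth_form (R : realType) (n : nat) (M : manifold R n)
    (w : form1 M) : Prop :=
  (forall c d x, atlas M c -> atlas M d -> cdom c x -> cdom d x ->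
     w c x = tmap c d id x *m w d x) /\
  (forall c, atlas M c -> forall k : 'I_n,
     smooth_on (cmap c @` cdom c) (fun y => w c (cinv c y) k 0)).

Definition dfun (R : realType) (n : nat) (M : manifold R n) (f : M -> R) :
    form1 M :=
  fun c x => \col_k 'D_(delta_mx 0 k) (f \o cinv c) (cmap c x).

(* A 2-form W is represented in a chart by the matrix of its values
   W(d_k, d_l) on the coordinate vector fields; the normalization is
   (v ^ w)(X, Y) = v(X) w(Y) - v(Y) w(X) and
   dw(X, Y) = X(w(Y)) - Y(w(X)) - w([X, Y]). *)
Definition wedge (R : realType) (n : nat) (v w : 'cV[R]_n) : 'M[R]_n :=
  v *m w^T - w *m v^T.

Definition dform (R : realType) (n : nat) (M : manifold R n) (w : form1 M)
    (c : chart R n M) (x : M) : 'M[R]_n :=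
  \matrix_(k, l)
    ('D_(delta_mx 0 k) (fun y => w c (cinv c y) l 0) (cmap c x)
     - 'D_(delta_mx 0 l) (fun y => w c (cinv c y) k 0) (cmap c x)).

(* A frame e_i^alpha (components in a chart) is written e alpha i. *)
Definition frame (R : realType) (p q : nat) : Type :=
  'I_p -> 'I_q -> 'rV[R]_(p * q).

Definition in_frame (R : realType) (p q : nat) (e : frame R p q)
    (z : 'I_p -> 'I_q -> R) : 'rV[R]_(p * q) :=
  \sum_alpha \sum_i z alpha i *: e alpha i.

(* The family of adapted frames is part of the data.  It is a single class
   under e_i^alpha |-> A_beta^alpha A_i^j e_j^beta; for p <> q this is the set
   of all frames presenting the cones, while for p = q the cones alone do not
   distinguish the two kinds of indices. *)
Record ag_structure (R : realType) (p q : nat) (M : manifold R (p * q)) :=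
  AGStructure {
  cone : chart R (p * q) M -> M -> set 'rV[R]_(p * q);
  adapted : chart R (p * q) M -> M -> set (frame R p q);
  cone_change : forall c d x, atlas M c -> atlas M d -> cdom c x -> cdom d x ->
    cone d x = (fun z => z *m tmap c d id x) @` cone c x;
  adapted_change : forall c d x,
    atlas M c -> atlas M d -> cdom c x -> cdom d x ->
    adapted d x =
      (fun e alpha i => e alpha i *m tmap c d id x) @` adapted c x;
  adapted_basis : forall c x e, atlas M c -> cdom c x -> adapted c x e ->
    forall z, exists! t, z = in_frame e t;
  adapted_cone : forall c x e, atlas M c -> cdom c x -> adapted c x e ->
    cone c x = [set z | exists (t : 'I_p -> R) (s : 'I_q -> R),
                          z = in_frame e (fun alpha i => t alpha * s i)];
  adapted_related : forall c x e, atlas M c -> cdom c x -> adapted c x e ->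
    forall e', adapted c x e' <->
      exists (A : 'M[R]_p) (A' : 'M[R]_q),
        [/\ A \in unitmx, A' \in unitmx &
            forall alpha i, e' alpha i =
              in_frame e (fun beta j => A alpha beta * A' i j)];
  adapted_smooth : forall x, exists c (V : set M) (e : M -> frame R p q),
    [/\ atlas M c, open V /\ V x, V `<=` cdom c,
        (forall y, V y -> adapted c y (e y)) &
        forall alpha i k,
          smooth_on (cmap c @` V) (fun y => e (cinv c y) alpha i 0 k)] }.

Definition delta (R : realType) (n : nat) (i j : 'I_n) : R := (i == j)%:R.

(* Notation, for Greek indices in 'I_p and Latin ones in 'I_q:
     th alpha i   = omega_alpha^i      wp alpha beta = omega_alpha^beta
     wq j i       = omega_j^i          wh            = omega
     wv i alpha   = omega_i^alpha
   Structure functions take their upper indices first, then the lower ones: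
     ta i beta gamma alpha j k         = a^{i beta gamma}_{alpha j k}
     tb1 i gamma delta j k l           = b^{i gamma delta}_{j k l}
     tb2 beta gamma delta alpha k l    = b^{beta gamma delta}_{alpha k l}
     tc alpha beta gamma i j k         = c^{alpha beta gamma}_{i j k}. *)
Record ag_bundle (R : realType) (p q : nat) (M : manifold R (p * q))
    (G : ag_structure M) := AGBundle {
  total :> manifold R (2 * (p * q) + p ^ 2 + q ^ 2 - 1);
  proj : total -> M;
  proj_bundle : fiber_bundle proj;

  th : 'I_p -> 'I_q -> form1 total;
  wp : 'I_p -> 'I_p -> form1 total;
  wq : 'I_q -> 'I_q -> form1 total;
  wh : form1 total;
  wv : 'I_q -> 'I_p -> form1 total;
  th_smooth : forall alpha i, smooth_form (th alpha i);
  wp_smooth : forall alpha beta, smooth_form (wp alpha beta);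
  wq_smooth : forall j i, smooth_form (wq j i);
  wh_smooth : smooth_form wh;
  wv_smooth : forall i alpha, smooth_form (wv i alpha);

  (* the th are the coframe forms of adapted frames *)
  th_coframe : forall (u : total) c, atlas M c -> cdom c (proj u) ->
    exists2 e, adapted G c (proj u) e &
      forall b, atlas total b -> cdom b u ->
      forall v, v *m tmap b c proj u =
        in_frame e (fun alpha i => (v *m th alpha i b u) 0 0);

  wp_trace : forall b u, atlas total b -> cdom b u ->
    \sum_gamma wp gamma gamma b u = 0;
  wq_trace : forall b u, atlas total b -> cdom b u ->
    \sum_k wq k k b u = 0;
  forms_span : forall b u, atlas total b -> cdom b u ->
    forall w, exists (x : 'I_p -> 'I_q -> R) (y : 'I_p -> 'I_p -> R)
        (y' : 'I_q -> 'I_q -> R) (z : R) (t : 'I_q -> 'I_p -> R),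
      w = \sum_alpha \sum_i x alpha i *: th alpha i b u
        + \sum_alpha \sum_beta y alpha beta *: wp alpha beta b u
        + \sum_j \sum_i y' j i *: wq j i b u
        + z *: wh b u
        + \sum_i \sum_alpha t i alpha *: wv i alpha b u;
  (* the only linear relations are the multiples of the trace conditions *)
  forms_indep : forall b u, atlas total b -> cdom b u ->
    forall (x : 'I_p -> 'I_q -> R) (y : 'I_p -> 'I_p -> R)
        (y' : 'I_q -> 'I_q -> R) (z : R) (t : 'I_q -> 'I_p -> R),
      \sum_alpha \sum_i x alpha i *: th alpha i b u
        + \sum_alpha \sum_beta y alpha beta *: wp alpha beta b u
        + \sum_j \sum_i y' j i *: wq j i b u
        + z *: wh b u
        + \sum_i \sum_alpha t i alpha *: wv i alpha b u = 0 ->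
      [/\ (forall alpha i, x alpha i = 0),
          (exists l, forall alpha beta, y alpha beta = l * delta R alpha beta),
          (exists l, forall j i, y' j i = l * delta R j i),
          z = 0 &
          (forall i alpha, t i alpha = 0)];

  ta : 'I_q -> 'I_p -> 'I_p -> 'I_p -> 'I_q -> 'I_q -> total -> R;
  tb1 : 'I_q -> 'I_p -> 'I_p -> 'I_q -> 'I_q -> 'I_q -> total -> R;
  tb2 : 'I_p -> 'I_p -> 'I_p -> 'I_p -> 'I_q -> 'I_q -> total -> R;
  tc : 'I_p -> 'I_p -> 'I_p -> 'I_q -> 'I_q -> 'I_q -> total -> R;
  ta_smooth : forall i beta gamma alpha j k,
    smooth_fun (ta i beta gamma alpha j k);
  tb1_smooth : forall i gamma delta j k l,
    smooth_fun (tb1 i gamma delta j k l);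
  tb2_smooth : forall beta gamma delta alpha k l,
    smooth_fun (tb2 beta gamma delta alpha k l);
  tc_smooth : forall alpha beta gamma i j k,
    smooth_fun (tc alpha beta gamma i j k);

  struct_th : forall b u, atlas total b -> cdom b u -> forall alpha i,
    dform (th alpha i) b u
      - \sum_j wedge (th alpha j b u) (wq j i b u)
      - \sum_beta wedge (wp alpha beta b u) (th beta i b u)
      - wedge (wh b u) (th alpha i b u)
    = \sum_beta \sum_gamma \sum_j \sum_k
        ta i beta gamma alpha j k u *: wedge (th beta j b u) (th gamma k b u);
  struct_wp : forall b u, atlas total b -> cdom b u -> forall alpha beta,
    dform (wp alpha beta) b u
      - \sum_gamma wedge (wp alpha gamma b u) (wp gamma beta b u)
    = (q%:R / (p + q)%:R) *:
        (delta R alpha beta *: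
           \sum_gamma \sum_k wedge (th gamma k b u) (wv k gamma b u)
         - p%:R *: \sum_k wedge (th alpha k b u) (wv k beta b u))
      + \sum_gamma \sum_delta \sum_k \sum_l
          tb2 beta gamma delta alpha k l u *:
            wedge (th gamma k b u) (th delta l b u);
  struct_wq : forall b u, atlas total b -> cdom b u -> forall j i,
    dform (wq j i) b u
      - \sum_k wedge (wq j k b u) (wq k i b u)
    = (p%:R / (p + q)%:R) *:
        (delta R j i *:
           \sum_gamma \sum_k wedge (wv k gamma b u) (th gamma k b u)
         - q%:R *: \sum_gamma wedge (wv j gamma b u) (th gamma i b u))
      + \sum_gamma \sum_delta \sum_k \sum_l
          tb1 i gamma delta j k l u *:
            wedge (th gamma k b u) (th delta l b u);
  struct_wh : forall b u, atlas total b -> cdom b u ->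
    dform wh b u
    = \sum_i \sum_alpha wedge (wv i alpha b u) (th alpha i b u);
  struct_wv : forall b u, atlas total b -> cdom b u -> forall i alpha,
    dform (wv i alpha) b u
      - \sum_beta wedge (wv i beta b u) (wp beta alpha b u)
      - \sum_j wedge (wq i j b u) (wv j alpha b u)
      + wedge (wh b u) (wv i alpha b u)
    = \sum_beta \sum_gamma \sum_j \sum_k
        tc alpha beta gamma i j k u *: wedge (th gamma k b u) (th beta j b u)
      - \sum_beta \sum_gamma \sum_j \sum_k
          ta k alpha beta gamma i j u *: wedge (wv k gamma b u) (th beta j b u);

  ta_skew : forall u i beta gamma alpha j k,
    ta i beta gamma alpha j k u = - ta i gamma beta alpha k j u;
  ta_trace_p : forall u i gamma j k,
    \sum_alpha ta i alpha gamma alpha j k u = 0;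
  ta_trace_q : forall u beta gamma alpha k,
    \sum_i ta i beta gamma alpha i k u = 0;
  tb2_skew : forall u beta gamma delta alpha k l,
    tb2 beta gamma delta alpha k l u = - tb2 beta delta gamma alpha l k u;
  tb1_skew : forall u i gamma delta j k l,
    tb1 i gamma delta j k l u = - tb1 i delta gamma j l k u;
  tb2_trace : forall u gamma delta k l,
    \sum_alpha tb2 alpha gamma delta alpha k l u = 0;
  tb1_trace : forall u gamma delta k l,
    \sum_i tb1 i gamma delta i k l u = 0;
  tb_normal : forall u gamma delta k l,
    \sum_alpha tb2 gamma alpha delta alpha k l u
      - \sum_i tb1 i gamma delta k i l u
      + \sum_alpha tb2 delta alpha gamma alpha l k u
      - \sum_i tb1 i delta gamma l i k u = 0;
  tc_skew : forall u alpha beta gamma i j k,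
    tc alpha beta gamma i j k u = - tc alpha gamma beta i k j u;
  tc_alt : forall u alpha beta gamma i j k,
    tc alpha beta gamma i j k u + tc beta gamma alpha j k i u
      + tc gamma alpha beta k i j u - tc beta alpha gamma j i k u
      - tc alpha gamma beta i k j u - tc gamma beta alpha k j i u = 0 }.

Arguments th {R p q M G} S : rename.
Arguments wp {R p q M G} S : rename.
Arguments wq {R p q M G} S : rename.
Arguments wh {R p q M G} S : rename.
Arguments wv {R p q M G} S : rename.
Arguments ta {R p q M G} S : rename.
Arguments tb1 {R p q M G} S : rename.
Arguments tb2 {R p q M G} S : rename.
Arguments tc {R p q M G} S : rename.

(* D eps m is the Pfaffian derivative of f along omega_eps^m. *)
Definition pfaffian (R : realType) (p q : nat) (M : manifold R (p * q))
    (G : ag_structure M) (S : ag_bundle G) (f : S -> R)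
    (D : 'I_p -> 'I_q -> S -> R) : Prop :=
  forall u : S,
  exists (y : 'I_p -> 'I_p -> R) (y' : 'I_q -> 'I_q -> R) (z : R)
      (t : 'I_q -> 'I_p -> R),
  forall b, atlas S b -> cdom b u ->
    dfun f b u = \sum_eps \sum_m D eps m u *: th S eps m b u
      + \sum_alpha \sum_beta y alpha beta *: wp S alpha beta b u
      + \sum_j \sum_i y' j i *: wq S j i b u
      + z *: wh S b u
      + \sum_i \sum_alpha t i alpha *: wv S i alpha b u.

Inductive comp_ab1 (p q : nat) : Type :=
| A1 of 'I_q & 'I_p & 'I_p & 'I_p & 'I_q & 'I_q
| B1 of 'I_q & 'I_p & 'I_p & 'I_q & 'I_q & 'I_q.

Inductive comp_ab2 (p q : nat) : Type :=
| A2 of 'I_q & 'I_p & 'I_p & 'I_p & 'I_q & 'I_q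
| B2 of 'I_p & 'I_p & 'I_p & 'I_p & 'I_q & 'I_q.

Definition val_ab1 (R : realType) (p q : nat) (M : manifold R (p * q))
    (G : ag_structure M) (S : ag_bundle G) (v : comp_ab1 p q) : S -> R :=
  match v with
  | A1 i beta gamma alpha j k => ta S i beta gamma alpha j k
  | B1 i gamma delta j k l => tb1 S i gamma delta j k l
  end.

Definition val_ab2 (R : realType) (p q : nat) (M : manifold R (p * q))
    (G : ag_structure M) (S : ag_bundle G) (v : comp_ab2 p q) : S -> R :=
  match v with
  | A2 i beta gamma alpha j k => ta S i beta gamma alpha j k
  | B2 beta gamma delta alpha k l => tb2 S beta gamma delta alpha k l
  end.

Arguments val_ab1 {R p q M G} S v.
Arguments val_ab2 {R p q M G} S v.

(* Formulas in the components indexed by V and their Pfaffian derivatives. *)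
Inductive formula (p q : nat) (V : Type) : Type :=
| FConst of rat
| FComp of V
| FPfaff of V & 'I_p & 'I_q
| FAdd of formula p q V & formula p q V
| FMul of formula p q V & formula p q V.

Fixpoint feval (R : realType) (p q : nat) (V : Type) (val : V -> R)
    (der : V -> 'I_p -> 'I_q -> R) (F : formula p q V) {struct F} : R :=
  match F with
  | FConst r => ratr r
  | FComp v => val v
  | FPfaff v eps m => der v eps m
  | FAdd F1 F2 => feval val der F1 + feval val der F2
  | FMul F1 F2 => feval val der F1 * feval val der F2
  end.

(* Main.v *)
Require Import Defs.
From HB Require Import structures.
From mathcomp Require Import all_boot all_order all_algebra.
From mathcomp Require Import all_classical all_reals all_analysis.
From mathcomp Require Import ring.
Set Implicit Arguments.
Unset Strict Implicit.
Unset Printing Implicit Defensive.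
Import Order.TTheory GRing.Theory Num.Theory.
Import numFieldNormedType.Exports.
Local Open Scope classical_set_scope.
Local Open Scope ring_scope.

(** Write theta_alpha^i for the basis forms of the coframe. The structure
equation of omega_alpha^beta contains the term theta_alpha^k /\ omega_k^beta
with a nonzero constant factor, and the exterior derivative of omega_k^beta
contains c theta /\ theta. Hence d d omega_alpha^beta = 0 is a linear relation
between c, the Pfaffian derivatives of b^2, and products of b^2 with the
torsion a; its theta /\ theta /\ theta part says that the alternation over
(eps, m), (gamma, j), (delta, l) of

  delta_alpha^eps c^{beta gamma delta}_{m j l}

is a universal expression in (a, b^2) and derivatives of b^2. (The other
occurrence of c, through the term theta_gamma^k /\ omega_k^gamma, drops out
because the full alternation of c vanishes.) As soon as p > 2 one may choose
eps = alpha distinct from both gamma and delta: a single term of the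
alternation survives, and as c is skew in its last two index pairs the
relation is solved for that component of c. For q > 2 the same argument is
applied to omega_j^i, the free index being now a Latin one.

The relation is read off without a calculus of 3-forms. In a chart, 2-forms
are evaluated on constant vector fields, whose brackets vanish, so that
dW(X, Y, Z) is the cyclic sum of X(W(Y, Z)); [has_extd] packages this, and
[has_extd_extd] is d d = 0, which rests on the symmetry of second partial
derivatives [schwarz]. At a point X, Y, Z are taken [horizontal]: dual to the
theta's and annihilated by all other forms of the structure. On such vectors
every term containing a fiber form vanishes, and [tc_from_tb2], [tc_from_tb1]
are what remains. The universality of the formulas is the closure of
[expressible] functions under sums and products. *)

(** * Symmetry of second derivatives *)

Lemma derivable_line (R : realType) (V : normedModType R) (f : V -> R)
    (x e : V) (s : R) :
  derivable f (x + s *: e) e ->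
  is_derive s 1 (fun t => f (x + t *: e)) ('D_e f (x + s *: e)).
Proof.
have E : (fun h : R => h^-1 *: (((fun t => f (x + t *: e)) \o shift s) (h *: 1)
            - f (x + s *: e))) =
         (fun h : R => h^-1 *: ((f \o shift (x + s *: e)) (h *: e)
            - f (x + s *: e))).
  apply/funext => h /=; congr (_ *: (f _ - _)).
  by rewrite [h *: 1]mulr1 scalerDl addrCA.
by move=> df; apply: DeriveDef; rewrite /derivable /derive E.
Qed.

Lemma is_derive_translate (R : realType) (V : normedModType R) (f : V -> R)
    (x a e : V) :
  derivable f (x + a) e ->
  is_derive x e (fun y => f (y + a)) ('D_e f (x + a)).
Proof.
have E : (fun h : R => h^-1 *: (((fun y => f (y + a)) \o shift x) (h *: e)
            - f (x + a))) =
         (fun h : R => h^-1 *: ((f \o shift (x + a)) (h *: e) - f (x + a))).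
  by apply/funext => h /=; rewrite addrA.
by move=> df; apply: DeriveDef; rewrite /derivable /derive E.
Qed.

Lemma MVT_line (R : realType) (V : normedModType R) (f : V -> R) (x e : V)
    (h : R) : 0 < h ->
  (forall s, 0 <= s <= h -> derivable f (x + s *: e) e) ->
  exists2 s, 0 < s < h & f (x + h *: e) - f x = h * 'D_e f (x + s *: e).
Proof.
move=> h0 df.
have dline s : s \in `[0, h] ->
    is_derive s 1 (fun t => f (x + t *: e)) ('D_e f (x + s *: e)).
  by rewrite in_itv => /df; exact: derivable_line.
have cline : {within `[0, h], continuous (fun t : R => f (x + t *: e))}.
  by apply: derivable_within_continuous => s /dline [].
have dline' s : s \in `]0, h[ ->
    is_derive s 1 (fun t => f (x + t *: e)) ('D_e f (x + s *: e)).
  by move=> /subset_itv_oo_cc; exact: dline.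
have [s sh E] := MVT h0 dline' cline.
exists s; first by move: sh; rewrite in_itv.
by move: E; rewrite scale0r addr0 subr0 mulrC.
Qed.

(** The mean value theorem along e1 for the increment of f in direction e2,
then along e2 for 'D_e1 f. Both mixed derivatives are compared through this
difference, which is symmetric in e1 and e2. *)
Lemma second_difference (R : realType) (V : normedModType R) (f : V -> R)
    (x e1 e2 : V) (h : R) : 0 < h ->
  (forall s t, 0 <= s <= h -> 0 <= t <= h ->
     derivable f (x + s *: e1 + t *: e2) e1 /\
     derivable ('D_e1 f) (x + s *: e1 + t *: e2) e2) ->
  exists s t, [/\ 0 < s < h, 0 < t < h &
    f (x + h *: e1 + h *: e2) - f (x + h *: e1) - f (x + h *: e2) + f x
    = h ^+ 2 * 'D_e2 ('D_e1 f) (x + s *: e1 + t *: e2)].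
Proof.
move=> h0 df; pose g y := f (y + h *: e2) - f y.
have hh : 0 <= h <= h by rewrite lexx ltW.
have h00 : 0 <= (0 : R) <= h by rewrite lexx ltW.
have dg s : 0 <= s <= h -> is_derive (x + s *: e1) e1 g
    ('D_e1 f (x + s *: e1 + h *: e2) - 'D_e1 f (x + s *: e1)).
  move=> sh; apply: is_deriveB.
    by apply: is_derive_translate; have [] := df s h sh hh.
  by have [+ _] := df s 0 sh h00; rewrite scale0r addr0 => /derivableP.
have dg1 s : 0 <= s <= h -> derivable g (x + s *: e1) e1 by move=> /dg [].
have [s sh gE] := MVT_line (f := g) (e := e1) h0 dg1.
have sh' : 0 <= s <= h by case/andP: sh => *; rewrite !ltW.
have [t th tE] := MVT_line (f := 'D_e1 f) (x := x + s *: e1) (e := e2) h0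
  (fun t th => (df s t sh' th).2).
exists s, t; split => //.
move: gE; rewrite (@derive_val _ _ _ _ _ _ _ (dg s sh')) tE /g => gE.
by rewrite expr2 -mulrA -gE; ring.
Qed.

Lemma dist_le_split (R : realFieldType) (eps a b c : R) :
  `|a - c| < eps / 2 -> `|b - c| < eps / 2 -> `|a - b| <= eps.
Proof.
move=> ac bc; rewrite -(subrKA c) (le_trans (ler_normD _ _))//.
by rewrite (splitr eps) lerD ?ltW// distrC.
Qed.

(** The second difference of f over a small parallelogram at x, divided by
h^2, is the value of either mixed derivative at some point of that
parallelogram; both are continuous at x, so they agree there. *)
Lemma schwarz (R : realType) (V : normedModType R) (U : set V) (f : V -> R)
    (x e1 e2 : V) : open U -> U x ->
  (forall y, U y -> derivable f y e1 /\ derivable f y e2) ->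
  (forall y, U y -> derivable ('D_e1 f) y e2 /\ derivable ('D_e2 f) y e1) ->
  {for x, continuous ('D_e2 ('D_e1 f))} ->
  {for x, continuous ('D_e1 ('D_e2 f))} ->
  'D_e2 ('D_e1 f) x = 'D_e1 ('D_e2 f) x.
Proof.
move=> oU Ux df ddf c21 c12; apply/eqP; rewrite -subr_eq0 -normr_le0.
apply/ler_addgt0Pr => eps eps0; rewrite add0r.
have e20 : 0 < eps / 2 by rewrite divr_gt0.
have [r /= r0 rP] : exists2 r : R, 0 < r & forall y, `|x - y| < r ->
    [/\ U y, `|'D_e2 ('D_e1 f) x - 'D_e2 ('D_e1 f) y| < eps / 2 &
        `|'D_e1 ('D_e2 f) x - 'D_e1 ('D_e2 f) y| < eps / 2].
  have nU : nbhs x U by apply: open_nbhs_nbhs.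
  have n21 : \forall y \near x,
      `|'D_e2 ('D_e1 f) x - 'D_e2 ('D_e1 f) y| < eps / 2.
    by have /cvgrPdist_lt/(_ _ e20) := c21.
  have n12 : \forall y \near x,
      `|'D_e1 ('D_e2 f) x - 'D_e1 ('D_e2 f) y| < eps / 2.
    by have /cvgrPdist_lt/(_ _ e20) := c12.
  have [r r0 rUP] := (nbhs_normP _ _).1 (filterI nU (filterI n21 n12)).
  by exists r => // y /rUP[? []].
(* this step h keeps the whole parallelogram x + s e1 + t e2 in the r-ball *)
pose k := `|e1| + `|e2| + 1; pose h := r / k.
have k0 : 0 < k by rewrite ltr_wpDl// addr_ge0.
have h0 : 0 < h by rewrite divr_gt0.
have near_x s t : 0 <= s <= h -> 0 <= t <= h ->
    `|x - (x + s *: e1 + t *: e2)| < r.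
  move=> /andP[s0 sh] /andP[t0 th].
  rewrite opprD addrA opprD addrA subrr add0r -opprD normrN.
  apply: (le_lt_trans (ler_normD _ _)); rewrite !normrZ !ger0_norm//.
  apply: (@le_lt_trans _ _ (h * `|e1| + h * `|e2|)).
    by rewrite lerD// ler_wpM2r.
  rewrite -mulrDr -[ltRHS](@divfK _ k) ?gt_eqF// -/h ltr_pM2l// /k.
  by rewrite ltrDl.
have swap s t : x + t *: e2 + s *: e1 = x + s *: e1 + t *: e2 by rewrite addrAC.
have [s [t [sh th E1]]] : exists s t, [/\ 0 < s < h, 0 < t < h &
    f (x + h *: e1 + h *: e2) - f (x + h *: e1) - f (x + h *: e2) + f x
    = h ^+ 2 * 'D_e2 ('D_e1 f) (x + s *: e1 + t *: e2)].
  apply: (second_difference h0) => s t sh th.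
  have [Uy _ _] := rP _ (near_x s t sh th).
  exact: conj (df _ Uy).1 (ddf _ Uy).1.
have [t' [s' [th' sh' E2]]] : exists t s, [/\ 0 < t < h, 0 < s < h &
    f (x + h *: e2 + h *: e1) - f (x + h *: e2) - f (x + h *: e1) + f x
    = h ^+ 2 * 'D_e1 ('D_e2 f) (x + t *: e2 + s *: e1)].
  apply: (second_difference h0) => t1 s1 ht hs; rewrite swap.
  have [Uy _ _] := rP _ (near_x s1 t1 hs ht).
  exact: conj (df _ Uy).2 (ddf _ Uy).2.
have wk (a : R) : 0 < a < h -> 0 <= a <= h by case/andP=> *; rewrite !ltW.
have [_ P1 _] := rP _ (near_x s t (wk _ sh) (wk _ th)).
have [_ _ P2] := rP _ (near_x s' t' (wk _ sh') (wk _ th')).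
have E : 'D_e2 ('D_e1 f) (x + s *: e1 + t *: e2)
       = 'D_e1 ('D_e2 f) (x + s' *: e1 + t' *: e2).
  apply: (@mulfI _ (h ^+ 2)); first by rewrite sqrf_eq0 gt_eqF.
  apply: (etrans (esym E1)); rewrite (swap s' t') (swap h h) in E2.
  rewrite -{}E2; congr (_ + _); exact: addrAC.
by rewrite -E in P2; exact: dist_le_split P1 P2.
Qed.

(** * Evaluation of 1-forms and 2-forms on vectors *)

Definition ev1 (R : realType) n (w : 'cV[R]_n) (X : 'rV[R]_n) : R :=
  (X *m w) 0 0.

Definition ev2 (R : realType) n (W : 'M[R]_n) (X Y : 'rV[R]_n) : R :=
  (X *m W *m Y^T) 0 0.

Lemma ev1D (R : realType) n (v w : 'cV[R]_n) X :
  ev1 (v + w) X = ev1 v X + ev1 w X.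
Proof. by rewrite /ev1 mulmxDr mxE. Qed.

Lemma ev1N (R : realType) n (v : 'cV[R]_n) X : ev1 (- v) X = - ev1 v X.
Proof. by rewrite /ev1 mulmxN mxE. Qed.

Lemma ev1Z (R : realType) n a (v : 'cV[R]_n) X : ev1 (a *: v) X = a * ev1 v X.
Proof. by rewrite /ev1 -scalemxAr mxE. Qed.

Lemma ev10 (R : realType) n X : ev1 (0 : 'cV[R]_n) X = 0.
Proof. by rewrite /ev1 mulmx0 mxE. Qed.

Lemma ev1_sum (R : realType) n (I : finType) (v : I -> 'cV[R]_n) X :
  ev1 (\sum_i v i) X = \sum_i ev1 (v i) X.
Proof. by rewrite /ev1 mulmx_sumr summxE. Qed.

Lemma ev2D (R : realType) n (v w : 'M[R]_n) X Y :
  ev2 (v + w) X Y = ev2 v X Y + ev2 w X Y.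
Proof. by rewrite /ev2 mulmxDr mulmxDl mxE. Qed.

Lemma ev2N (R : realType) n (v : 'M[R]_n) X Y : ev2 (- v) X Y = - ev2 v X Y.
Proof. by rewrite /ev2 mulmxN mulNmx mxE. Qed.

Lemma ev2Z (R : realType) n a (v : 'M[R]_n) X Y :
  ev2 (a *: v) X Y = a * ev2 v X Y.
Proof. by rewrite /ev2 -scalemxAr -scalemxAl mxE. Qed.

Lemma ev2_sum (R : realType) n (I : finType) (v : I -> 'M[R]_n) X Y :
  ev2 (\sum_i v i) X Y = \sum_i ev2 (v i) X Y.
Proof. by rewrite /ev2 mulmx_sumr mulmx_suml summxE. Qed.

Lemma ev2_tr (R : realType) n (W : 'M[R]_n) X Y : ev2 W^T X Y = ev2 W Y X.
Proof.
by rewrite /ev2 -[in LHS](trmxK X) -trmx_mul -trmx_mul mxE mulmxA.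
Qed.

Lemma ev2_wedge (R : realType) n (v w : 'cV[R]_n) X Y :
  ev2 (wedge v w) X Y = ev1 v X * ev1 w Y - ev1 w X * ev1 v Y.
Proof.
have E (a c : 'cV[R]_n) : ev2 (a *m c^T) X Y = ev1 a X * ev1 c Y.
  rewrite /ev2 mulmxA -mulmxA -trmx_mul mxE big_ord1 /ev1.
  by congr (_ * _); rewrite mxE.
by rewrite /wedge ev2D ev2N !E.
Qed.

(** * Exterior derivative of 2-forms in coordinates *)

Definition has_grad (R : realType) n (f : 'rV[R]_n -> R) (y : 'rV[R]_n)
    (g : 'cV[R]_n) : Prop :=
  forall m, is_derive y (delta_mx 0 m) f (g m 0).

Lemma has_grad_near (R : realType) n (f f' : 'rV[R]_n -> R) y g :
  (\near y, f y = f' y) -> has_grad f y g -> has_grad f' y g.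
Proof. by move=> ff' fg m; exact: near_eq_is_derive ff' (fg m). Qed.

Lemma has_grad_uniq (R : realType) n (f : 'rV[R]_n -> R) y g g' :
  has_grad f y g -> has_grad f y g' -> g = g'.
Proof.
move=> fg fg'; apply/matrixP => m k; rewrite (ord1 k).
by have [_ <-] := fg m; have [_ <-] := fg' m.
Qed.

Lemma has_grad_cst (R : realType) n (a : R) (y : 'rV[R]_n) :
  has_grad (fun=> a) y 0.
Proof. by move=> m; rewrite mxE; exact: is_derive_cst. Qed.

Lemma has_gradD (R : realType) n (f f' : 'rV[R]_n -> R) y g g' :
  has_grad f y g -> has_grad f' y g' ->
  has_grad (fun z => f z + f' z) y (g + g').
Proof. by move=> fg fg' m; rewrite mxE; exact: is_deriveD. Qed.

Lemma has_gradM (R : realType) n (f f' : 'rV[R]_n -> R) y g g' :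
  has_grad f y g -> has_grad f' y g' ->
  has_grad (fun z => f z * f' z) y (f y *: g' + f' y *: g).
Proof. by move=> fg fg' m; rewrite !mxE; exact: is_deriveM. Qed.

Lemma has_gradZ (R : realType) n a (f : 'rV[R]_n -> R) y g :
  has_grad f y g -> has_grad (fun z => a * f z) y (a *: g).
Proof.
by move=> fg; have := has_gradM (has_grad_cst a y) fg; rewrite scaler0 addr0.
Qed.

Lemma has_gradN (R : realType) n (f : 'rV[R]_n -> R) y g :
  has_grad f y g -> has_grad (fun z => - f z) y (- g).
Proof. by move=> fg m; rewrite mxE; exact: is_deriveN. Qed.

Lemma has_grad_sum (R : realType) n (I : finType) (f : I -> 'rV[R]_n -> R) y
    (g : I -> 'cV[R]_n) :
  (forall i, has_grad (f i) y (g i)) ->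
  has_grad (fun z => \sum_i f i z) y (\sum_i g i).
Proof.
move=> fg; elim: (index_enum I) => [|i r IHr].
  rewrite big_nil; under eq_fun do rewrite big_nil; exact: has_grad_cst.
rewrite big_cons; under eq_fun do rewrite big_cons.
exact: has_gradD (fg i) IHr.
Qed.

(** The columns of J are the gradients of the components, so that the exterior
derivative of w has the matrix J - J^T. *)
Definition has_jac (R : realType) n (w : 'rV[R]_n -> 'cV[R]_n) (y : 'rV[R]_n)
    (J : 'M[R]_n) : Prop :=
  forall k, has_grad (fun z => w z k 0) y (col k J).

Lemma has_grad_ev1 (R : realType) n (w : 'rV[R]_n -> 'cV[R]_n) y J X :
  has_jac w y J -> has_grad (fun z => ev1 (w z) X) y (J *m X^T).
Proof.
move=> wJ.
have -> : (fun z => ev1 (w z) X) = (fun z => \sum_k X 0 k * w z k 0).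
  by apply/funext => z; rewrite /ev1 mxE.
have -> : J *m X^T = \sum_k X 0 k *: col k J.
  apply/matrixP => m l; rewrite mxE summxE; apply: eq_bigr => k _.
  by rewrite !mxE (ord1 l) mulrC.
by apply: has_grad_sum => k; exact: has_gradZ.
Qed.

(** T is the 3-form dW at y, as a function of three vectors: for constant
vector fields the brackets vanish and
dW(X, Y, Z) = X(W(Y, Z)) + Y(W(Z, X)) + Z(W(X, Y)). *)
Definition has_extd (R : realType) n (W : 'rV[R]_n -> 'M[R]_n) (y : 'rV[R]_n)
    (T : 'rV[R]_n -> 'rV[R]_n -> 'rV[R]_n -> R) : Prop :=
  exists g : 'rV[R]_n -> 'rV[R]_n -> 'cV[R]_n,
    (forall X Y, has_grad (fun z => ev2 (W z) X Y) y (g X Y)) /\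
    (forall X Y Z, T X Y Z = ev1 (g Y Z) X + ev1 (g Z X) Y + ev1 (g X Y) Z).

Lemma has_extd_near (R : realType) n (W W' : 'rV[R]_n -> 'M[R]_n) y T :
  (\near y, W y = W' y) -> has_extd W y T -> has_extd W' y T.
Proof.
move=> WW' [g [Wg Tg]]; exists g; split=> // X Y.
apply: has_grad_near (Wg X Y).
by apply: filterS WW' => z ->.
Qed.

Lemma has_extd_uniq (R : realType) n (W : 'rV[R]_n -> 'M[R]_n) y T T' X Y Z :
  has_extd W y T -> has_extd W y T' -> T X Y Z = T' X Y Z.
Proof.
move=> [g [Wg ->]] [g' [Wg' ->]].
have E A B : g A B = g' A B := has_grad_uniq (Wg A B) (Wg' A B).
by rewrite !E.
Qed.

Lemma has_extdD (R : realType) n (W W' : 'rV[R]_n -> 'M[R]_n) y T T' :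
  has_extd W y T -> has_extd W' y T' ->
  has_extd (fun z => W z + W' z) y (fun X Y Z => T X Y Z + T' X Y Z).
Proof.
move=> [g [Wg Tg]] [g' [Wg' Tg']]; exists (fun X Y => g X Y + g' X Y).
split=> [X Y|X Y Z]; last by rewrite Tg Tg' !ev1D; ring.
by under eq_fun do rewrite ev2D; exact: has_gradD.
Qed.

Lemma has_extd_scale (R : realType) n (f : 'rV[R]_n -> R) g
    (W : 'rV[R]_n -> 'M[R]_n) y T :
  has_grad f y g -> has_extd W y T ->
  has_extd (fun z => f z *: W z) y (fun X Y Z =>
    ev1 g X * ev2 (W y) Y Z + ev1 g Y * ev2 (W y) Z X + ev1 g Z * ev2 (W y) X Y
    + f y * T X Y Z).
Proof.
move=> fg [h [Wh Th]].
exists (fun X Y => f y *: h X Y + ev2 (W y) X Y *: g).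
split=> [X Y|X Y Z]; last by rewrite Th !ev1D !ev1Z; ring.
by under eq_fun do rewrite ev2Z; exact: has_gradM.
Qed.

Lemma has_extdZ (R : realType) n a (W : 'rV[R]_n -> 'M[R]_n) y T :
  has_extd W y T ->
  has_extd (fun z => a *: W z) y (fun X Y Z => a * T X Y Z).
Proof.
move=> /(has_extd_scale (has_grad_cst a y)).
congr has_extd; apply/funext => X; apply/funext => Y; apply/funext => Z.
by rewrite !ev10 !mul0r !add0r.
Qed.

Lemma has_extdB (R : realType) n (W W' : 'rV[R]_n -> 'M[R]_n) y T T' :
  has_extd W y T -> has_extd W' y T' ->
  has_extd (fun z => W z - W' z) y (fun X Y Z => T X Y Z - T' X Y Z).
Proof.
move=> WT /(has_extdZ (-1)) WT'.
have := has_extdD WT WT'.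
under eq_fun do rewrite scaleN1r.
by congr has_extd; apply/funext => X; apply/funext => Y; apply/funext => Z;
  rewrite mulN1r.
Qed.

Lemma has_extd_sum (R : realType) n (I : finType)
    (W : I -> 'rV[R]_n -> 'M[R]_n) y T :
  (forall i, has_extd (W i) y (T i)) ->
  has_extd (fun z => \sum_i W i z) y (fun X Y Z => \sum_i T i X Y Z).
Proof.
move=> WT; have /choice[g gP] := WT.
exists (fun X Y => \sum_i g i X Y); split=> [X Y|X Y Z].
  under eq_fun do rewrite ev2_sum.
  by apply: has_grad_sum => i; exact: (gP i).1.
rewrite !ev1_sum -!big_split; apply: eq_bigr => i _; exact: (gP i).2.
Qed.

(** The Leibniz rule d(v /\ w) = dv /\ w - v /\ dw. *)
Lemma has_extd_wedge (R : realType) n (v w : 'rV[R]_n -> 'cV[R]_n) y Jv Jw :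
  has_jac v y Jv -> has_jac w y Jw ->
  has_extd (fun z => wedge (v z) (w z)) y (fun X Y Z =>
    (ev2 (Jv - Jv^T) X Y * ev1 (w y) Z + ev2 (Jv - Jv^T) Y Z * ev1 (w y) X
     + ev2 (Jv - Jv^T) Z X * ev1 (w y) Y)
    - (ev1 (v y) X * ev2 (Jw - Jw^T) Y Z + ev1 (v y) Y * ev2 (Jw - Jw^T) Z X
     + ev1 (v y) Z * ev2 (Jw - Jw^T) X Y)).
Proof.
move=> vJ wJ.
exists (fun X Y =>
  (ev1 (v y) X *: (Jw *m Y^T) + ev1 (w y) Y *: (Jv *m X^T))
  - (ev1 (w y) X *: (Jv *m Y^T) + ev1 (v y) Y *: (Jw *m X^T))).
split=> [X Y|X Y Z].
  under eq_fun do rewrite ev2_wedge.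
  apply: has_gradD; last apply: has_gradN.
    exact: has_gradM (has_grad_ev1 X vJ) (has_grad_ev1 Y wJ).
  exact: has_gradM (has_grad_ev1 X wJ) (has_grad_ev1 Y vJ).
have E (J : 'M[R]_n) (a c : 'rV[R]_n) : ev1 (J *m a^T) c = ev2 J c a.
  by rewrite /ev1 /ev2 mulmxA.
rewrite !(ev1D, ev1N, ev1Z, E, ev2D, ev2N, ev2_tr); ring.
Qed.

Lemma smooth_on_derivable (R : realType) n (U : set 'rV[R]_n)
    (f : 'rV[R]_n -> R) y : smooth_on U f -> U y ->
  has_grad f y (\col_k 'D_(delta_mx 0 k) f y).
Proof.
move=> /(_ 1%N)[_ df] Uy m; rewrite mxE; apply: derivableP.
exact: (df m).1.
Qed.

Lemma smooth_on_partial (R : realType) n (U : set 'rV[R]_n)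
    (f : 'rV[R]_n -> R) k : smooth_on U f ->
  smooth_on U ('D_(delta_mx 0 k) f).
Proof. by move=> sf j; exact: ((sf j.+1).2 k).2. Qed.

Lemma smooth_on_schwarz (R : realType) n (U : set 'rV[R]_n)
    (f : 'rV[R]_n -> R) y k l : open U -> smooth_on U f -> U y ->
  'D_(delta_mx 0 k) ('D_(delta_mx 0 l) f) y
  = 'D_(delta_mx 0 l) ('D_(delta_mx 0 k) f) y.
Proof.
move=> oU sf Uy.
have d1 (g : 'rV[R]_n -> R) (m : 'I_n) z : smooth_on U g -> U z ->
    derivable g z (delta_mx 0 m).
  by move=> sg Uz; have [] := smooth_on_derivable sg Uz m.
have sk m := smooth_on_partial m sf.
apply: (schwarz oU Uy).
- by move=> z Uz; split; exact: d1.
- by move=> z Uz; split; exact: d1.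
- exact: (smooth_on_partial k (sk l) 0%N).1.
- exact: (smooth_on_partial l (sk k) 0%N).1.
Qed.

Definition jac (R : realType) n (w : 'rV[R]_n -> 'cV[R]_n) (y : 'rV[R]_n) :
    'M[R]_n :=
  \matrix_(m, k) 'D_(delta_mx 0 m) (fun z => w z k 0) y.

Lemma smooth_on_jac (R : realType) n (U : set 'rV[R]_n)
    (w : 'rV[R]_n -> 'cV[R]_n) y :
  (forall k, smooth_on U (fun z => w z k 0)) -> U y -> has_jac w y (jac w y).
Proof.
move=> sw Uy k m; rewrite !mxE.
by have := smooth_on_derivable (sw k) Uy m; rewrite mxE.
Qed.

Lemma ev2E (R : realType) n (W : 'M[R]_n) X Y :
  ev2 W X Y = \sum_k \sum_l X 0 k * Y 0 l * W k l.
Proof.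
rewrite exchange_big /ev2 mxE; apply: eq_bigr => l _.
rewrite !mxE mulr_suml; apply: eq_bigr => k _; ring.
Qed.

(** H k l m stands for the second derivative along the m-th and k-th coordinates
of the l-th component of a 1-form. *)
Lemma contract_sym (R : realType) n (H : 'I_n -> 'I_n -> 'cV[R]_n)
    (X Y Z : 'rV[R]_n) : (forall k l m, H k l m 0 = H m l k 0) ->
  ev1 (\sum_k \sum_l (Y 0 k * Z 0 l) *: H k l) X
  = ev1 (\sum_k \sum_l (X 0 k * Z 0 l) *: H k l) Y.
Proof.
move=> Hsym.
have E (A B : 'rV[R]_n) : ev1 (\sum_k \sum_l (A 0 k * Z 0 l) *: H k l) B
    = \sum_k \sum_m \sum_l A 0 k * Z 0 l * (B 0 m * H k l m 0).
  rewrite ev1_sum; apply: eq_bigr => k _; rewrite ev1_sum exchange_big.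
  by apply: eq_bigr => l _; rewrite ev1Z /ev1 mxE mulr_sumr.
rewrite !E exchange_big; apply: eq_bigr => k _; apply: eq_bigr => m _.
apply: eq_bigr => l _; rewrite (Hsym m l k) (mulrC _ (Z 0 l)).
by rewrite (mulrC _ (Z 0 l)) -!mulrA; congr (_ * _); rewrite mulrCA.
Qed.

(** d d w = 0: the six second derivatives of w in the cyclic sum cancel in
pairs, those of one pair differing by the order of differentiation. *)
Lemma has_extd_extd (R : realType) n (U : set 'rV[R]_n)
    (w : 'rV[R]_n -> 'cV[R]_n) y : open U ->
  (forall k, smooth_on U (fun z => w z k 0)) -> U y ->
  has_extd (fun z => jac w z - (jac w z)^T) y (fun _ _ _ => 0).
Proof.
move=> oU sw Uy.
pose H k l : 'cV[R]_n := \col_m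
  'D_(delta_mx 0 m) ('D_(delta_mx 0 k) (fun z => w z l 0)) y.
have Hsym k l m : H k l m 0 = H m l k 0.
  rewrite /H [LHS]mxE [RHS]mxE. exact: (smooth_on_schwarz _ _ oU (sw l) Uy).
pose h (X Y : 'rV[R]_n) := \sum_k \sum_l (X 0 k * Y 0 l) *: H k l.
have Hgrad k l : has_grad (fun z => jac w z k l) y (H k l).
  under eq_fun do rewrite mxE.
  exact: (smooth_on_derivable (smooth_on_partial k (sw l)) Uy).
have hgrad X Y : has_grad (fun z => ev2 (jac w z) X Y) y (h X Y).
  under eq_fun do rewrite ev2E.
  by apply: has_grad_sum => k; apply: has_grad_sum => l; exact: has_gradZ.
have hsym X Y Z : ev1 (h Y Z) X = ev1 (h X Z) Y := contract_sym X Y Z Hsym.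
exists (fun X Y => h X Y - h Y X); split=> [X Y|X Y Z].
  under eq_fun do rewrite ev2D ev2N ev2_tr.
  by apply: has_gradD; last exact: has_gradN.
rewrite !ev1D !ev1N (hsym X Y Z) (hsym X Z Y) (hsym Y Z X).
move: (ev1 _ _) (ev1 _ _) (ev1 _ _) => a c d; ring.
Qed.

(** * Exterior derivative of 2-forms on a manifold *)

Lemma near_chart (R : realType) n (M : manifold R n) (b : chart R n M) (u : M)
    (T : Type) (f g : 'rV[R]_n -> T) : atlas M b -> cdom b u ->
  (forall x, cdom b x -> f (cmap b x) = g (cmap b x)) ->
  \forall y \near cmap b u, f y = g y.
Proof.
move=> bM bu fg; have [[_ oU] _ _ _] := mfd_chart bM.
have nU : nbhs (cmap b u) (cmap b @` cdom b).
  by apply: open_nbhs_nbhs; split => //; exists u.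
by apply: filterS nU => _ [x bx <-]; exact: fg.
Qed.

Lemma cinvK (R : realType) n (M : manifold R n) (b : chart R n M) (u : M) :
  atlas M b -> cdom b u -> cinv b (cmap b u) = u.
Proof. by move=> bM; have [_ bK _ _] := mfd_chart bM; exact: bK. Qed.

Lemma dfun_grad (R : realType) n (M : manifold R n) (f : M -> R) b u :
  smooth_fun f -> atlas M b -> cdom b u ->
  has_grad (fun z => f (cinv b z)) (cmap b u) (dfun f b u).
Proof.
move=> sf bM bu.
by apply: (smooth_on_derivable (sf b bM)); exists u.
Qed.

Lemma dformE (R : realType) n (M : manifold R n) (w : form1 M) b u :
  dform w b u = jac (fun y => w b (cinv b y)) (cmap b u)
                - (jac (fun y => w b (cinv b y)) (cmap b u))^T.
Proof. by apply/matrixP => k l; rewrite !mxE. Qed.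

Lemma form_jac (R : realType) n (M : manifold R n) (w : form1 M) b u :
  smooth_form w -> atlas M b -> cdom b u ->
  has_jac (fun y => w b (cinv b y)) (cmap b u)
    (jac (fun y => w b (cinv b y)) (cmap b u)).
Proof.
move=> [_ sw] bM bu; apply: (smooth_on_jac (U := cmap b @` cdom b)).
  exact: (sw b bM).
by exists u.
Qed.

Lemma dform_extd (R : realType) n (M : manifold R n) (w : form1 M) b u :
  smooth_form w -> atlas M b -> cdom b u ->
  has_extd (fun z => dform w b (cinv b z)) (cmap b u) (fun _ _ _ => 0).
Proof.
move=> [_ sw] bM bu; have [[_ oU] _ _ _] := mfd_chart bM.
pose wloc y := w b (cinv b y).
have Uu : (cmap b @` cdom b) (cmap b u) by exists u.
apply: has_extd_near (has_extd_extd (w := wloc) oU (sw b bM) Uu).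
apply: (near_chart (f := fun z => jac wloc z - (jac wloc z)^T)
  (g := fun z => dform w b (cinv b z)) bM bu) => x bx.
by rewrite (cinvK bM bx) dformE.
Qed.

(** The 3-form dv /\ w - v /\ dw, with the exterior derivatives of the forms
kept unexpanded so that the structure equations can be substituted for them. *)
Definition dwedge (R : realType) n (M : manifold R n) (v w : form1 M) b u
    (X Y Z : 'rV[R]_n) : R :=
  (ev2 (dform v b u) X Y * ev1 (w b u) Z
   + ev2 (dform v b u) Y Z * ev1 (w b u) X
   + ev2 (dform v b u) Z X * ev1 (w b u) Y)
  - (ev1 (v b u) X * ev2 (dform w b u) Y Z
     + ev1 (v b u) Y * ev2 (dform w b u) Z X
     + ev1 (v b u) Z * ev2 (dform w b u) X Y).

Lemma wedge_extd (R : realType) n (M : manifold R n) (v w : form1 M) b u :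
  smooth_form v -> smooth_form w -> atlas M b -> cdom b u ->
  has_extd (fun z => wedge (v b (cinv b z)) (w b (cinv b z))) (cmap b u)
    (dwedge v w b u).
Proof.
move=> sv sw bM bu.
have := has_extd_wedge (form_jac sv bM bu) (form_jac sw bM bu).
by rewrite -!dformE !(cinvK bM bu).
Qed.

Lemma scale_wedge_extd (R : realType) n (M : manifold R n) (f : M -> R)
    (v w : form1 M) b u : smooth_fun f ->
  smooth_form v -> smooth_form w -> atlas M b -> cdom b u ->
  has_extd (fun z => f (cinv b z) *: wedge (v b (cinv b z)) (w b (cinv b z)))
    (cmap b u) (fun X Y Z =>
      ev1 (dfun f b u) X * ev2 (wedge (v b u) (w b u)) Y Z
      + ev1 (dfun f b u) Y * ev2 (wedge (v b u) (w b u)) Z X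
      + ev1 (dfun f b u) Z * ev2 (wedge (v b u) (w b u)) X Y
      + f u * dwedge v w b u X Y Z).
Proof.
move=> sf sv sw bM bu.
have := has_extd_scale (dfun_grad sf bM bu) (wedge_extd sv sw bM bu).
by rewrite !(cinvK bM bu).
Qed.

(** A structure equation dw = W holds in a whole chart domain, hence may be
differentiated; the result is d d w = 0. *)
Lemma d2_zero (R : realType) n (M : manifold R n) (w : form1 M)
    (W : M -> 'M[R]_n) b u T X Y Z :
  smooth_form w -> atlas M b -> cdom b u ->
  (forall x, cdom b x -> dform w b x = W x) ->
  has_extd (fun z => W (cinv b z)) (cmap b u) T -> T X Y Z = 0.
Proof.
move=> sw bM bu wW WT.
apply: (has_extd_uniq X Y Z WT); apply: has_extd_near (dform_extd sw bM bu).
apply: (near_chart (f := fun z => dform w b (cinv b z))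
  (g := fun z => W (cinv b z)) bM bu) => x bx.
by rewrite (cinvK bM bx) wW.
Qed.

Lemma dwedge_vertical (R : realType) n (M : manifold R n) (v w : form1 M) b u
    X Y Z : (forall V, V \in [:: X; Y; Z] -> ev1 (v b u) V = 0) ->
  (forall V, V \in [:: X; Y; Z] -> ev1 (w b u) V = 0) ->
  dwedge v w b u X Y Z = 0.
Proof.
move=> v0 w0; rewrite /dwedge !v0 ?w0 ?inE ?eqxx ?orbT//.
by rewrite !mulr0 !mul0r !addr0 subr0.
Qed.

(** * Contractions with Kronecker symbols *)

Lemma sum_delta (R : pzRingType) (T : finType) (f : T -> R) a :
  \sum_s f s * (s == a)%:R = f a.
Proof.
rewrite (bigD1 a)//= eqxx mulr1 big1 ?addr0// => s /negbTE ->.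
by rewrite mulr0.
Qed.

Lemma sum_pair (R : nmodType) (I J : finType) (F : I * J -> R) :
  \sum_s F s = \sum_a \sum_j F (a, j).
Proof. by rewrite pair_bigA; apply: eq_bigr => -[]. Qed.

Lemma sum_pair4 (R : nmodType) (I J : finType) (F : I * J -> I * J -> R) :
  \sum_a \sum_b \sum_j \sum_k F (a, j) (b, k) = \sum_s \sum_t F s t.
Proof.
rewrite sum_pair; apply: eq_bigr => a _; rewrite exchange_big.
by apply: eq_bigr => j _; rewrite sum_pair.
Qed.

Section Contraction.
Variables (R : comPzRingType) (T : finType).
Implicit Types (f B : T -> T -> R) (g : T -> R).
Local Notation K s a := ((s == a)%:R : R).

Lemma contract_delta2 f a c :
  \sum_s \sum_t f s t * (K s a * K t c) = f a c.
Proof.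
rewrite -[RHS](sum_delta (f^~ c)); apply: eq_bigr => s _.
rewrite -[in RHS](sum_delta (f s)) mulr_suml; apply: eq_bigr => t _.
by rewrite [in LHS](mulrC (K s a)) mulrA.
Qed.

Lemma contract_deltar f g c :
  \sum_s \sum_t f s t * (g s * K t c) = \sum_s f s c * g s.
Proof.
apply: eq_bigr => s _; rewrite -[in RHS](sum_delta (f s)) mulr_suml.
by apply: eq_bigr => t _; rewrite (mulrC (g s)) mulrA.
Qed.

Lemma contract_deltal f g a :
  \sum_s \sum_t f s t * (K s a * g t) = \sum_t f a t * g t.
Proof.
rewrite exchange_big; apply: eq_bigr => t _.
rewrite -[in RHS](sum_delta (f^~ t)) mulr_suml.
by apply: eq_bigr => s _; rewrite mulrA.
Qed.

(** Value of the 2-form f theta /\ theta on the vectors dual to the basis forms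
a and c. *)
Lemma contract_wedge f a c :
  \sum_s \sum_t f s t * (K s a * K t c - K t a * K s c) = f a c - f c a.
Proof.
under eq_bigr => s _.
  under eq_bigr => t _ do rewrite mulrBr (mulrC (K t a)).
  rewrite sumrB; over.
by rewrite sumrB !contract_delta2.
Qed.

(** Value of B d(theta /\ theta) on three basis vectors; g1, g2 and g3 are the
components of d theta on the three pairs of vectors. *)
Lemma contract_dwedge B (g1 g2 g3 : T -> R) a1 a2 a3 :
  \sum_s \sum_t B s t *
    ((g1 s * K t a1 + g2 s * K t a2 + g3 s * K t a3)
     - (K s a1 * g1 t + K s a2 * g2 t + K s a3 * g3 t))
  = \sum_t (B t a1 - B a1 t) * g1 t + \sum_t (B t a2 - B a2 t) * g2 t
    + \sum_t (B t a3 - B a3 t) * g3 t.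
Proof.
have E (g : T -> R) a : \sum_t (B t a - B a t) * g t
    = \sum_s \sum_t B s t * (g s * K t a) - \sum_s \sum_t B s t * (K s a * g t).
  rewrite contract_deltar contract_deltal -sumrB.
  by apply: eq_bigr => t _; rewrite mulrBl.
rewrite !E -!sumrB -!big_split; apply: eq_bigr => s _.
rewrite -!sumrB -!big_split; apply: eq_bigr => t _ /=; ring.
Qed.
End Contraction.

(** The value of d(B theta /\ theta) on three basis vectors when
d theta = A theta /\ theta up to terms with fiber forms; DB s t r is the
Pfaffian derivative of B s t along r. The differences B t z - B z t arise from
differentiating either factor of theta /\ theta. *)
Definition bianchi_cycle (R : pzRingType) (T : finType) (B : T -> T -> R)
    (DB A : T -> T -> T -> R) (s1 s2 s3 : T) : R :=
  let term x y z := DB y z x - DB z y x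
    + \sum_t (B t z - B z t) * (A t x y - A t y x) in
  term s1 s2 s3 + term s2 s3 s1 + term s3 s1 s2.

(** * Horizontal vectors *)

(** If w is not in the span of the f j, the cokernel of the matrix with
rows f j contains a vector on which w does not vanish. *)
Lemma separating_vector (R : fieldType) n (J : finType) (f : J -> 'cV[R]_n)
    (w : 'cV[R]_n) : (forall c : J -> R, w <> \sum_j c j *: f j) ->
  exists X : 'rV[R]_n, (X *m w) 0 0 = 1 /\ forall j, (X *m f j) 0 0 = 0.
Proof.
move=> wf; pose A : 'M[R]_(#|J|, n) := \matrix_(r, k) f (enum_val r) k 0.
have wA : ~~ (w^T <= A)%MS.
  apply/negP => /submxP[D wD]; apply: (wf (fun j => D 0 (enum_rank j))).
  apply/matrixP => k l; have := congr1 (fun B : 'rV_n => B 0 k) wD.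
  rewrite !mxE (ord1 l) => ->; rewrite summxE.
  rewrite (reindex (@enum_rank J)) /=; last first.
    by apply: onW_bij; exact: enum_rank_bij.
  by apply: eq_bigr => j _; rewrite !mxE enum_rankK.
move: wA; rewrite submxE => /rV0Pn[k wk].
set a := (w^T *m cokermx A) 0 k in wk.
have colE (v : 'cV[R]_n) : ((col k (cokermx A))^T *m v) 0 0
    = (v^T *m cokermx A) 0 k.
  by rewrite !mxE; apply: eq_bigr => i _; rewrite !mxE mulrC.
exists (a^-1 *: (col k (cokermx A))^T).
split=> [|j]; rewrite -scalemxAl mxE colE; first by rewrite mulVf.
have -> : (f j)^T = row (enum_rank j) A.
  by apply/matrixP => r i; rewrite !mxE enum_rankK (ord1 r).
by rewrite -row_mul mulmx_coker row0 mxE mulr0.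
Qed.

Section Horizontal.
Variables (R : realType) (p q : nat) (M : manifold R (p * q)).
Variables (G : ag_structure M) (S : ag_bundle G).
Local Notation vec := 'rV[R]_(2 * (p * q) + p ^ 2 + q ^ 2 - 1).

(** The vector of the frame dual to the structure forms that corresponds to
theta_{s.1}^{s.2}. *)
Definition horizontal b (u : S) (s : 'I_p * 'I_q) (X : vec) : Prop :=
  [/\ (forall t, ev1 (th S t.1 t.2 b u) X = (t == s)%:R),
      (forall alpha beta, ev1 (wp S alpha beta b u) X = 0),
      (forall j i, ev1 (wq S j i b u) X = 0),
      ev1 (wh S b u) X = 0 &
      (forall i alpha, ev1 (wv S i alpha b u) X = 0)].

(** The only linear relations between the structure forms are the trace
conditions, which do not involve the theta's; so no theta is a combination of
the other forms. *)
Lemma horizontal_exists b u s : atlas S b -> cdom b u ->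
  exists X, horizontal b u s X.
Proof.
move=> bS bu.
pose J := (('I_p * 'I_q) + ('I_p * 'I_p) + ('I_q * 'I_q) + unit
           + ('I_q * 'I_p))%type.
(* theta_s is replaced by 0 rather than removed, which keeps the index type a
   plain sum *)
pose f (j : J) := match j with
  | inl (inl (inl (inl t))) => if t == s then 0 else th S t.1 t.2 b u
  | inl (inl (inl (inr t))) => wp S t.1 t.2 b u
  | inl (inl (inr t)) => wq S t.1 t.2 b u
  | inl (inr _) => wh S b u
  | inr t => wv S t.1 t.2 b u end.
have [c cE|X [Xs Xf]] := @separating_vector R _ J f (th S s.1 s.2 b u).
  (* the coefficients of the relation - theta_s + sum of the other forms = 0 *)
  pose c1 alpha i : R := if (alpha, i) == s then -1
    else c (inl (inl (inl (inl (alpha, i))))).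
  have E : \sum_alpha \sum_i c1 alpha i *: th S alpha i b u
      = \sum_t c (inl (inl (inl (inl t)))) *: f (inl (inl (inl (inl t))))
        - th S s.1 s.2 b u.
    rewrite -(sum_pair (fun t => c1 t.1 t.2 *: th S t.1 t.2 b u)).
    rewrite (bigD1 s)//= [X in _ = X - _](bigD1 s)//= eqxx scaler0 add0r.
    rewrite /c1 -surjective_pairing eqxx scaleN1r addrC; congr (_ - _).
    by apply: eq_bigr => t /negbTE ts; rewrite -surjective_pairing ts.
  suff /(forms_indep bS bu)[/(_ s.1 s.2) /eqP + _ _ _ _] :
      \sum_alpha \sum_i c1 alpha i *: th S alpha i b u
      + \sum_alpha \sum_beta
          c (inl (inl (inl (inr (alpha, beta))))) *: wp S alpha beta b u
      + \sum_j \sum_i c (inl (inl (inr (j, i)))) *: wq S j i b u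
      + c (inl (inr tt)) *: wh S b u
      + \sum_i \sum_alpha c (inr (i, alpha)) *: wv S i alpha b u = 0.
    by rewrite /c1 -surjective_pairing eqxx oppr_eq0 oner_eq0.
  rewrite E !(addrAC _ (- th S s.1 s.2 b u)).
  apply/eqP; rewrite subr_eq0 [in X in _ == X]cE !big_sumType /=.
  by rewrite (big_pred1 tt) => [|[]//]; rewrite !sum_pair.
exists X; split=> [t|alpha beta|j i||i alpha].
- have [->|ts] := eqVneq t s; first exact: Xs.
  by have := Xf (inl (inl (inl (inl t)))); rewrite /f (negbTE ts).
- exact: (Xf (inl (inl (inl (inr (alpha, beta)))))).
- exact: (Xf (inl (inl (inr (j, i))))).
- exact: (Xf (inl (inr tt))).
- exact: (Xf (inr (i, alpha))).
Qed.

End Horizontal.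

(** * The structure forms on horizontal vectors *)

Section Evaluation.
Variables (R : realType) (p q : nat) (M : manifold R (p * q)).
Variables (G : ag_structure M) (S : ag_bundle G).
Variables (b : chart R (2 * (p * q) + p ^ 2 + q ^ 2 - 1) S) (u : S).
Hypotheses (bS : atlas S b) (bu : cdom b u).
Local Notation hor := (horizontal b u).
Implicit Types s : ('I_p * 'I_q)%type.

Lemma wedge_th_hor s1 s2 X Y (c : 'I_p -> 'I_p -> 'I_q -> 'I_q -> R) :
  hor s1 X -> hor s2 Y ->
  \sum_beta \sum_gamma \sum_j \sum_k
    c beta gamma j k * ev2 (wedge (th S beta j b u) (th S gamma k b u)) X Y
  = c s1.1 s2.1 s1.2 s2.2 - c s2.1 s1.1 s2.2 s1.2.
Proof.
move=> [hX _ _ _ _] [hY _ _ _ _].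
rewrite (sum_pair4 (fun s t => c s.1 t.1 s.2 t.2 *
  ev2 (wedge (th S s.1 s.2 b u) (th S t.1 t.2 b u)) X Y)).
under eq_bigr => s _ do under eq_bigr => t _ do rewrite ev2_wedge !hX !hY.
exact: (contract_wedge (fun s t => c s.1 t.1 s.2 t.2)).
Qed.

Lemma ev2_wedge0 (v w : 'cV[R]_(2 * (p * q) + p ^ 2 + q ^ 2 - 1)) X Y :
  ev1 v X = 0 -> ev1 v Y = 0 -> ev2 (wedge v w) X Y = 0.
Proof. by move=> vX vY; rewrite ev2_wedge vX vY mul0r mulr0 subr0. Qed.

Lemma ev2_wedge0r (v w : 'cV[R]_(2 * (p * q) + p ^ 2 + q ^ 2 - 1)) X Y :
  ev1 w X = 0 -> ev1 w Y = 0 -> ev2 (wedge v w) X Y = 0.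
Proof. by move=> wX wY; rewrite ev2_wedge wX wY mul0r mulr0 subr0. Qed.

Lemma wedge_th_hor_scale s1 s2 X Y (c : 'I_p -> 'I_p -> 'I_q -> 'I_q -> R) :
  hor s1 X -> hor s2 Y ->
  ev2 (\sum_beta \sum_gamma \sum_j \sum_k
    c beta gamma j k *: wedge (th S beta j b u) (th S gamma k b u)) X Y
  = c s1.1 s2.1 s1.2 s2.2 - c s2.1 s1.1 s2.2 s1.2.
Proof.
move=> hX hY; rewrite -(wedge_th_hor c hX hY) ev2_sum.
apply: eq_bigr => beta _; rewrite ev2_sum; apply: eq_bigr => gamma _.
rewrite ev2_sum; apply: eq_bigr => j _; rewrite ev2_sum.
by apply: eq_bigr => k _; rewrite ev2Z.
Qed.

(** Every term of the structure equation with a fiber form vanishes, leaving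
the torsion. *)
Lemma dth_hor s1 s2 X Y t : hor s1 X -> hor s2 Y ->
  ev2 (dform (th S t.1 t.2) b u) X Y
  = ta S t.2 s1.1 s2.1 t.1 s1.2 s2.2 u - ta S t.2 s2.1 s1.1 t.1 s2.2 s1.2 u.
Proof.
move=> hX hY.
rewrite -(wedge_th_hor_scale
  (fun beta gamma j k => ta S t.2 beta gamma t.1 j k u) hX hY).
rewrite -(struct_th bS bu) 3!ev2D 3!ev2N 2!ev2_sum.
have [_ wpX wqX whX _] := hX; have [_ wpY wqY whY _] := hY.
rewrite big1 => [|j _]; last exact: ev2_wedge0r.
rewrite big1 => [|beta _]; last exact: ev2_wedge0.
by rewrite ev2_wedge0 // !subr0.
Qed.

(** On horizontal vectors c is all that remains of the curvature of
omega_i^alpha; the factor is -2 because c is skew and the two basis forms are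
wedged in the order opposite to that of the index pairs of c. *)
Lemma dwv_hor s1 s2 X Y i alpha : hor s1 X -> hor s2 Y ->
  ev2 (dform (wv S i alpha) b u) X Y
  = - 2 * tc S alpha s1.1 s2.1 i s1.2 s2.2 u.
Proof.
move=> hX hY.
have [_ wpX wqX whX wvX] := hX; have [_ wpY wqY whY wvY] := hY.
have := struct_wv bS bu i alpha => /(congr1 (fun W => ev2 W X Y)).
rewrite 3!ev2D 2!ev2N 2!ev2_sum.
rewrite big1 => [|beta _]; last exact: ev2_wedge0.
rewrite big1 => [|j _]; last exact: ev2_wedge0.
rewrite ev2_wedge0 // !subr0 addr0 => ->; rewrite ev2D ev2N.
rewrite [X in _ - X](_ : _ = 0) ?subr0; last first.
  rewrite ev2_sum big1 // => beta _; rewrite ev2_sum big1 // => gamma _.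
  rewrite ev2_sum big1 // => j _; rewrite ev2_sum big1 // => k _.
  by rewrite ev2Z ev2_wedge0 ?mulr0.
transitivity (ev2 (\sum_beta \sum_gamma \sum_j \sum_k
    tc S alpha gamma beta i k j u *:
      wedge (th S beta j b u) (th S gamma k b u)) X Y).
  congr (ev2 _ X Y); rewrite exchange_big; apply: eq_bigr => gamma _.
  by apply: eq_bigr => beta _; rewrite exchange_big.
rewrite (wedge_th_hor_scale
  (fun beta gamma j k => tc S alpha gamma beta i k j u) hX hY) /=.
rewrite tc_skew; ring.
Qed.

(** A horizontal vector annihilates the fiber forms, so it reads off a single
Pfaffian derivative. *)
Lemma pfaffian_hor (f : S -> R) D s X : pfaffian f D -> hor s X ->
  ev1 (dfun f b u) X = D s.1 s.2 u.
Proof.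
move=> fD [thX wpX wqX whX wvX].
have [y [y' [z [t /(_ b bS bu) ->]]]] := fD u.
rewrite !ev1D ev1Z whX mulr0 addr0 !ev1_sum.
rewrite [X in _ + X + _ + _](_ : _ = 0) ?addr0; last first.
  rewrite big1 // => alpha _; rewrite ev1_sum big1 // => beta _.
  by rewrite ev1Z wpX mulr0.
rewrite [X in _ + X + _](_ : _ = 0) ?addr0; last first.
  rewrite big1 // => j _; rewrite ev1_sum big1 // => i _.
  by rewrite ev1Z wqX mulr0.
rewrite [X in _ + X](_ : _ = 0) ?addr0; last first.
  rewrite big1 // => i _; rewrite ev1_sum big1 // => alpha _.
  by rewrite ev1Z wvX mulr0.
rewrite -[RHS](sum_delta (fun r => D r.1 r.2 u) s) sum_pair.
apply: eq_bigr => eps _; rewrite ev1_sum; apply: eq_bigr => m _.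
by rewrite ev1Z -(thX (eps, m)).
Qed.

Lemma dwedge_th_th s1 s2 s3 X Y Z r t (A := fun r' x y =>
    ta S r'.2 x.1 y.1 r'.1 x.2 y.2 u - ta S r'.2 y.1 x.1 r'.1 y.2 x.2 u) :
  hor s1 X -> hor s2 Y -> hor s3 Z ->
  dwedge (th S r.1 r.2) (th S t.1 t.2) b u X Y Z
  = (A r s1 s2 * (t == s3)%:R + A r s2 s3 * (t == s1)%:R
     + A r s3 s1 * (t == s2)%:R)
    - ((r == s3)%:R * A t s1 s2 + (r == s1)%:R * A t s2 s3
       + (r == s2)%:R * A t s3 s1).
Proof.
move=> hX hY hZ; rewrite /dwedge.
rewrite !(dth_hor _ hX hY) !(dth_hor _ hY hZ) !(dth_hor _ hZ hX).
move: hX hY hZ => [hX _ _ _ _] [hY _ _ _ _] [hZ _ _ _ _].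
rewrite !hX !hY !hZ; congr (_ + _); congr (- _).
by rewrite addrC addrA.
Qed.

(** Common to both structure equations used below: B is the curvature b^2 of
omega_alpha^beta or b^1 of omega_j^i, with the two indices of the form
fixed. *)
Lemma curvature_extd (B : 'I_p -> 'I_p -> 'I_q -> 'I_q -> S -> R)
    (DB : 'I_p -> 'I_p -> 'I_q -> 'I_q -> 'I_p -> 'I_q -> S -> R) :
  (forall beta gamma j k, smooth_fun (B beta gamma j k)) ->
  (forall beta gamma j k, pfaffian (B beta gamma j k) (DB beta gamma j k)) ->
  exists2 T,
    has_extd (fun z => \sum_beta \sum_gamma \sum_j \sum_k
      B beta gamma j k (cinv b z) *:
      wedge (th S beta j b (cinv b z)) (th S gamma k b (cinv b z))) (cmap b u) T
    & forall s1 s2 s3 X Y Z, hor s1 X -> hor s2 Y -> hor s3 Z ->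
      T X Y Z = bianchi_cycle (fun s t => B s.1 t.1 s.2 t.2 u)
        (fun s t r => DB s.1 t.1 s.2 t.2 r.1 r.2 u)
        (fun r x y => ta S r.2 x.1 y.1 r.1 x.2 y.2 u) s1 s2 s3.
Proof.
move=> sB dB.
pose t4 (s t : 'I_p * 'I_q) X Y Z :=
  ev1 (dfun (B s.1 t.1 s.2 t.2) b u) X *
    ev2 (wedge (th S s.1 s.2 b u) (th S t.1 t.2 b u)) Y Z
  + ev1 (dfun (B s.1 t.1 s.2 t.2) b u) Y *
    ev2 (wedge (th S s.1 s.2 b u) (th S t.1 t.2 b u)) Z X
  + ev1 (dfun (B s.1 t.1 s.2 t.2) b u) Z *
    ev2 (wedge (th S s.1 s.2 b u) (th S t.1 t.2 b u)) X Y
  + B s.1 t.1 s.2 t.2 u * dwedge (th S s.1 s.2) (th S t.1 t.2) b u X Y Z.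
exists (fun X Y Z => \sum_beta \sum_gamma \sum_j \sum_k
    t4 (beta, j) (gamma, k) X Y Z).
  do 4 (apply: has_extd_sum => ?).
  exact: scale_wedge_extd (sB _ _ _ _) (th_smooth _ _ _) (th_smooth _ _ _)
    bS bu.
move=> s1 s2 s3 X Y Z hX hY hZ; rewrite (sum_pair4 (fun s t => t4 s t X Y Z)).
have [thX _ _ _ _] := hX; have [thY _ _ _ _] := hY; have [thZ _ _ _ _] := hZ.
under eq_bigr => s _ do under eq_bigr => t _ do
  rewrite /t4 !ev2_wedge !thX !thY !thZ (pfaffian_hor (dB _ _ _ _) hX)
    (pfaffian_hor (dB _ _ _ _) hY) (pfaffian_hor (dB _ _ _ _) hZ)
    (dwedge_th_th _ _ hX hY hZ).
rewrite /bianchi_cycle.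
pose sum2 (F : 'I_p * 'I_q -> 'I_p * 'I_q -> R) := \sum_s \sum_t F s t.
have sum2D F F' : sum2 (fun s t => F s t + F' s t) = sum2 F + sum2 F'.
  by rewrite /sum2 -big_split; apply: eq_bigr => s _; rewrite big_split.
rewrite -/(sum2 _) !sum2D /sum2.
rewrite !contract_wedge contract_dwedge.
ring.
Qed.

End Evaluation.

(** * Solving the second order relation for c *)

Section Solve.
Variables (R : realType) (p q : nat) (M : manifold R (p * q)).
Variables (G : ag_structure M) (S : ag_bundle G).
Implicit Types (u : S) (s : ('I_p * 'I_q)%type).

(** As c is skew in its last two index pairs, its alternation is twice its
cyclic sum. *)
Lemma tc_cycle u alpha beta gamma i j k :
  tc S alpha beta gamma i j k u + tc S beta gamma alpha j k i u
  + tc S gamma alpha beta k i j u = 0.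
Proof.
have := tc_alt u alpha beta gamma i j k.
rewrite (tc_skew u beta alpha) (tc_skew u alpha gamma).
rewrite (tc_skew u gamma beta) => H.
by apply: (mulfI (_ : 2 != 0)); rewrite ?pnatr_eq0// mulr0 -H; ring.
Qed.

Lemma dwedge_th_wv b u s1 s2 s3 X Y Z i alpha t :
  atlas S b -> cdom b u ->
  horizontal b u s1 X -> horizontal b u s2 Y -> horizontal b u s3 Z ->
  dwedge (th S t.1 t.2) (wv S i alpha) b u X Y Z
  = 2 * (tc S alpha s2.1 s3.1 i s2.2 s3.2 u * (t == s1)%:R
         + tc S alpha s3.1 s1.1 i s3.2 s1.2 u * (t == s2)%:R
         + tc S alpha s1.1 s2.1 i s1.2 s2.2 u * (t == s3)%:R).
Proof.
move=> bS bu hX hY hZ.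
rewrite /dwedge (dwv_hor _ _ _ _ hX hY)// (dwv_hor _ _ _ _ hY hZ)//.
rewrite (dwv_hor _ _ _ _ hZ hX)//.
have [thX _ _ _ ->] := hX; have [thY _ _ _ ->] := hY.
have [thZ _ _ _ ->] := hZ; rewrite thX thY thZ; ring.
Qed.

Lemma dwedge_wv_th b u s1 s2 s3 X Y Z i alpha t :
  atlas S b -> cdom b u ->
  horizontal b u s1 X -> horizontal b u s2 Y -> horizontal b u s3 Z ->
  dwedge (wv S i alpha) (th S t.1 t.2) b u X Y Z
  = - (2 * (tc S alpha s2.1 s3.1 i s2.2 s3.2 u * (t == s1)%:R
         + tc S alpha s3.1 s1.1 i s3.2 s1.2 u * (t == s2)%:R
         + tc S alpha s1.1 s2.1 i s1.2 s2.2 u * (t == s3)%:R)).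
Proof.
move=> bS bu hX hY hZ.
rewrite /dwedge (dwv_hor _ _ _ _ hX hY)// (dwv_hor _ _ _ _ hY hZ)//.
rewrite (dwv_hor _ _ _ _ hZ hX)//.
have [thX _ _ _ ->] := hX; have [thY _ _ _ ->] := hY.
have [thZ _ _ _ ->] := hZ; rewrite thX thY thZ; ring.
Qed.

(** The trace term of the structure equations contributes only the cyclic sum
of c, that is nothing. *)
Lemma tc_trace_cycle u s1 s2 s3 :
  \sum_t (tc S t.1 s2.1 s3.1 t.2 s2.2 s3.2 u * (t == s1)%:R
         + tc S t.1 s3.1 s1.1 t.2 s3.2 s1.2 u * (t == s2)%:R
         + tc S t.1 s1.1 s2.1 t.2 s1.2 s2.2 u * (t == s3)%:R) = 0.
Proof.
rewrite !big_split /=.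
rewrite (sum_delta (fun t => tc S t.1 s2.1 s3.1 t.2 s2.2 s3.2 u)).
rewrite (sum_delta (fun t => tc S t.1 s3.1 s1.1 t.2 s3.2 s1.2 u)).
rewrite (sum_delta (fun t => tc S t.1 s1.1 s2.1 t.2 s1.2 s2.2 u)).
exact: tc_cycle.
Qed.

(** d d omega_eps^alpha = 0 on the vectors dual to (eps, i), (beta, j) and
(gamma, k). As eps differs from beta and gamma, theta_eps^k0 vanishes on the
last two, and theta_eps^k0 /\ omega_k0^alpha contributes one component of c
only. *)
Lemma tc_from_tb2
    (D : 'I_p -> 'I_p -> 'I_p -> 'I_p -> 'I_q -> 'I_q -> 'I_p -> 'I_q -> S -> R)
    u (eps alpha beta gamma : 'I_p) (i j k : 'I_q) :
  (forall b1 b2 b3 b4 k l,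
     pfaffian (tb2 S b1 b2 b3 b4 k l) (D b1 b2 b3 b4 k l)) ->
  eps != beta -> eps != gamma ->
  tc S alpha beta gamma i j k u
  = ((p + q)%:R / (2 * q * p)%:R) *
    bianchi_cycle (fun s t => tb2 S alpha s.1 t.1 eps s.2 t.2 u)
      (fun s t r => D alpha s.1 t.1 eps s.2 t.2 r.1 r.2 u)
      (fun r x y => ta S r.2 x.1 y.1 r.1 x.2 y.2 u)
      (eps, i) (beta, j) (gamma, k).
Proof.
move=> dD eb eg; have [b bS bu] := mfd_cover u.
have [X hX] := horizontal_exists (eps, i) bS bu.
have [Y hY] := horizontal_exists (beta, j) bS bu.
have [Z hZ] := horizontal_exists (gamma, k) bS bu.
have [T WT TE] := curvature_extd bS bu
  (fun b1 b2 j k => @tb2_smooth R p q M G S alpha b1 b2 eps j k)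
  (fun b1 b2 j k => dD alpha b1 b2 eps j k).
rewrite -(TE _ _ _ _ _ _ hX hY hZ).
have w12 := has_extd_sum (fun g : 'I_p => wedge_extd (wp_smooth S eps g)
  (wp_smooth S g alpha) bS bu).
have t1 := has_extd_sum (fun g : 'I_p => has_extd_sum (fun k : 'I_q =>
  wedge_extd (th_smooth S g k) (wv_smooth S k g) bS bu)).
have t2 := has_extd_sum (fun k : 'I_q =>
  wedge_extd (th_smooth S eps k) (wv_smooth S k alpha) bS bu).
have := has_extdD (has_extdD (has_extdZ (q%:R / (p + q)%:R)
  (has_extdB (has_extdZ (delta R eps alpha) t1) (has_extdZ p%:R t2))) WT) w12.
pose W x := (q%:R / (p + q)%:R) *:
        (delta R eps alpha *:
           (\sum_gamma \sum_k wedge (th S gamma k b x) (wv S k gamma b x))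
         - p%:R *: (\sum_k wedge (th S eps k b x) (wv S k alpha b x)))
      + (\sum_gamma \sum_delta \sum_k \sum_l
          tb2 S alpha gamma delta eps k l x *:
            wedge (th S gamma k b x) (th S delta l b x))
   + \sum_gamma wedge (wp S eps gamma b x) (wp S gamma alpha b x).
move=> /(d2_zero (W := W) X Y Z (wp_smooth S eps alpha) bS bu).
have sW x : cdom b x -> dform (wp S eps alpha) b x = W x.
  by move=> bx; rewrite /W -(struct_wp bS bx) subrK.
move=> /(_ sW) {sW W}.
have -> : \sum_g \sum_k0 dwedge (th S g k0) (wv S k0 g) b u X Y Z = 0.
  rewrite -(sum_pair (fun t => dwedge (th S t.1 t.2) (wv S t.2 t.1) b u X Y Z)).
  under eq_bigr => t _ do rewrite (dwedge_th_wv _ _ _ bS bu hX hY hZ).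
  by rewrite -mulr_sumr (tc_trace_cycle u (eps, i) (beta, j) (gamma, k)) mulr0.
have -> : \sum_k0 dwedge (th S eps k0) (wv S k0 alpha) b u X Y Z
    = 2 * tc S alpha beta gamma i j k u.
  rewrite -[in RHS](sum_delta (fun k0 => tc S alpha beta gamma k0 j k u) i).
  rewrite mulr_sumr; apply: eq_bigr => k0 _.
  rewrite (dwedge_th_wv k0 alpha (eps, k0) bS bu hX hY hZ) !xpair_eqE eqxx /=.
  by rewrite (negbTE eb) (negbTE eg) !mulr0 !addr0.
have -> : \sum_g dwedge (wp S eps g) (wp S g alpha) b u X Y Z = 0.
  rewrite big1 // => g _; have [_ wpX _ _ _] := hX.
  have [_ wpY _ _ _] := hY; have [_ wpZ _ _ _] := hZ.
  by rewrite dwedge_vertical // => V; rewrite !inE => /or3P[] /eqP->.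
rewrite mulr0 sub0r addr0 !(natrD, natrM) => H.
have p0 : (p%:R : R) != 0.
  by rewrite pnatr_eq0 -lt0n (leq_trans _ (ltn_ord eps)).
have q0 : (q%:R : R) != 0 by rewrite pnatr_eq0 -lt0n (leq_trans _ (ltn_ord i)).
have pq0 : (p%:R + q%:R : R) != 0.
  by rewrite gt_eqF // addr_gt0 // lt0r ler0n ?p0 ?q0.
have -> : T X Y Z
    = q%:R / (p%:R + q%:R) * (p%:R * (2 * tc S alpha beta gamma i j k u)).
  by apply/eqP; rewrite -subr_eq0 -H; apply/eqP; ring.
by field; rewrite pq0 p0 q0.
Qed.

(** The same with d d omega_i^m = 0 on the vectors dual to (alpha, m), (beta, j)
and (gamma, k): now theta_g^m vanishes on the last two. The sign comes from
the opposite order of the factors in omega_i^g /\ theta_g^m. *)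
Lemma tc_from_tb1
    (D : 'I_q -> 'I_p -> 'I_p -> 'I_q -> 'I_q -> 'I_q -> 'I_p -> 'I_q -> S -> R)
    u (alpha beta gamma : 'I_p) (m i j k : 'I_q) :
  (forall j1 g d j2 k l,
     pfaffian (tb1 S j1 g d j2 k l) (D j1 g d j2 k l)) ->
  m != j -> m != k ->
  tc S alpha beta gamma i j k u
  = - ((p + q)%:R / (2 * p * q)%:R) *
    bianchi_cycle (fun s t => tb1 S m s.1 t.1 i s.2 t.2 u)
      (fun s t r => D m s.1 t.1 i s.2 t.2 r.1 r.2 u)
      (fun r x y => ta S r.2 x.1 y.1 r.1 x.2 y.2 u)
      (alpha, m) (beta, j) (gamma, k).
Proof.
move=> dD mj mk; have [b bS bu] := mfd_cover u.
have [X hX] := horizontal_exists (alpha, m) bS bu.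
have [Y hY] := horizontal_exists (beta, j) bS bu.
have [Z hZ] := horizontal_exists (gamma, k) bS bu.
have [T WT TE] := curvature_extd bS bu
  (fun b1 b2 j k => @tb1_smooth R p q M G S m b1 b2 i j k)
  (fun b1 b2 j k => dD m b1 b2 i j k).
rewrite -(TE _ _ _ _ _ _ hX hY hZ).
have w12 := has_extd_sum (fun k : 'I_q => wedge_extd (wq_smooth S i k)
  (wq_smooth S k m) bS bu).
have t1 := has_extd_sum (fun g : 'I_p => has_extd_sum (fun k : 'I_q =>
  wedge_extd (wv_smooth S k g) (th_smooth S g k) bS bu)).
have t2 := has_extd_sum (fun g : 'I_p =>
  wedge_extd (wv_smooth S i g) (th_smooth S g m) bS bu).
have := has_extdD (has_extdD (has_extdZ (p%:R / (p + q)%:R)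
  (has_extdB (has_extdZ (delta R i m) t1) (has_extdZ q%:R t2))) WT) w12.
pose W x := (p%:R / (p + q)%:R) *:
        (delta R i m *:
           (\sum_gamma \sum_k wedge (wv S k gamma b x) (th S gamma k b x))
         - q%:R *: (\sum_gamma wedge (wv S i gamma b x) (th S gamma m b x)))
      + (\sum_gamma \sum_delta \sum_k \sum_l
          tb1 S m gamma delta i k l x *:
            wedge (th S gamma k b x) (th S delta l b x))
   + \sum_k wedge (wq S i k b x) (wq S k m b x).
move=> /(d2_zero (W := W) X Y Z (wq_smooth S i m) bS bu).
have sW x : cdom b x -> dform (wq S i m) b x = W x.
  by move=> bx; rewrite /W -(struct_wq bS bx) subrK.
move=> /(_ sW) {sW W}.
have -> : \sum_g \sum_k0 dwedge (wv S k0 g) (th S g k0) b u X Y Z = 0.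
  rewrite -(sum_pair (fun t => dwedge (wv S t.2 t.1) (th S t.1 t.2) b u X Y Z)).
  under eq_bigr => t _ do rewrite (dwedge_wv_th _ _ _ bS bu hX hY hZ).
  rewrite sumrN -mulr_sumr.
  by rewrite (tc_trace_cycle u (alpha, m) (beta, j) (gamma, k)) mulr0 oppr0.
have -> : \sum_g dwedge (wv S i g) (th S g m) b u X Y Z
    = - (2 * tc S alpha beta gamma i j k u).
  rewrite -[in RHS](sum_delta (fun g => tc S g beta gamma i j k u) alpha).
  rewrite mulr_sumr -sumrN; apply: eq_bigr => g _.
  rewrite (dwedge_wv_th i g (g, m) bS bu hX hY hZ) !xpair_eqE eqxx /=.
  by rewrite (negbTE mj) (negbTE mk) !andbF andbT !mulr0 !addr0.
have -> : \sum_k dwedge (wq S i k) (wq S k m) b u X Y Z = 0.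
  rewrite big1 // => k0 _; have [_ _ wqX _ _] := hX.
  have [_ _ wqY _ _] := hY; have [_ _ wqZ _ _] := hZ.
  by rewrite dwedge_vertical // => V; rewrite !inE => /or3P[] /eqP->.
rewrite mulr0 sub0r addr0 !(natrD, natrM) => H.
have p0 : (p%:R : R) != 0.
  by rewrite pnatr_eq0 -lt0n (leq_trans _ (ltn_ord alpha)).
have q0 : (q%:R : R) != 0 by rewrite pnatr_eq0 -lt0n (leq_trans _ (ltn_ord i)).
have pq0 : (p%:R + q%:R : R) != 0.
  by rewrite gt_eqF // addr_gt0 // lt0r ler0n ?p0 ?q0.
have -> : T X Y Z
    = - (p%:R / (p%:R + q%:R) * (q%:R * (2 * tc S alpha beta gamma i j k u))).
  by apply/eqP; rewrite -subr_eq0 -H; apply/eqP; ring.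
by field; rewrite pq0 p0 q0.
Qed.

End Solve.

(** * Universal formulas *)

Section Expressible.
Variables (R : realType) (p q : nat) (V : Type).
Local Notation pfun := ((V -> R) -> (V -> 'I_p -> 'I_q -> R) -> R).

(** E is a function of the values of the components and of their Pfaffian
derivatives at one point, so an expressible E is given by one formula for all
structures. *)
Definition expressible (E : pfun) : Prop :=
  exists F : formula p q V, forall val der, E val der = feval val der F.

Lemma expressible_cst (a : rat) : expressible (fun _ _ => ratr a).
Proof. by exists (FConst _ _ _ a). Qed.

Lemma expressible_comp v : expressible (fun val _ => val v).
Proof. by exists (FComp _ _ v). Qed.

Lemma expressible_pfaffian v eps m : expressible (fun _ der => der v eps m).
Proof. by exists (FPfaff v eps m). Qed.

Lemma expressibleD (E E' : pfun) : expressible E -> expressible E' ->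
  expressible (fun val der => E val der + E' val der).
Proof.
by move=> [F EF] [F' EF']; exists (FAdd F F') => val der; rewrite EF EF'.
Qed.

Lemma expressibleM (E E' : pfun) : expressible E -> expressible E' ->
  expressible (fun val der => E val der * E' val der).
Proof.
by move=> [F EF] [F' EF']; exists (FMul F F') => val der; rewrite EF EF'.
Qed.

Lemma expressibleZ (a : rat) (E : pfun) : expressible E ->
  expressible (fun val der => ratr a * E val der).
Proof. exact/expressibleM/expressible_cst. Qed.

Lemma expressibleB (E E' : pfun) : expressible E -> expressible E' ->
  expressible (fun val der => E val der - E' val der).
Proof.
move=> eE /(expressibleZ (-1))[F' EF']; have [F EF] := eE.
by exists (FAdd F F') => val der; rewrite /= -EF -EF' rmorphN1 mulN1r.
Qed.

Lemma expressible_sum (I : finType) (E : I -> pfun) :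
  (forall i, expressible (E i)) ->
  expressible (fun val der => \sum_i E i val der).
Proof.
move=> eE; elim: (index_enum I) => [|i r [F EF]].
  by have [F EF] := expressible_cst 0; exists F => val der;
    rewrite big_nil -EF rmorph0.
have [F' EF'] := eE i.
by exists (FAdd F' F) => val der; rewrite big_cons EF EF'.
Qed.

Lemma expressible_cycle (T : finType) (B : T -> T -> pfun)
    (DB A : T -> T -> T -> pfun) s1 s2 s3 :
  (forall s t, expressible (B s t)) ->
  (forall s t r, expressible (DB s t r)) ->
  (forall s t r, expressible (A s t r)) ->
  expressible (fun val der => bianchi_cycle (fun s t => B s t val der)
    (fun s t r => DB s t r val der) (fun s t r => A s t r val der) s1 s2 s3).
Proof.
move=> eB eDB eA.
have term x y z : expressible (fun val der =>
    DB y z x val der - DB z y x val der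
    + \sum_t (B t z val der - B z t val der)
              * (A t x y val der - A t y x val der)).
  apply: expressibleD; first exact: expressibleB.
  by apply: expressible_sum => t; apply: expressibleM; exact: expressibleB.
have term12 := expressibleD (term s1 s2 s3) (term s2 s3 s1).
exact: expressibleD term12 (term s3 s1 s2).
Qed.
End Expressible.

Lemma exists_ord_avoiding n (a c : 'I_n) : (2 < n)%N ->
  exists e : 'I_n, e != a /\ e != c.
Proof.
move=> n2; have : (0 < #|~: [set a; c]|)%N.
  rewrite cardsCs finset.setCK card_ord subn_gt0.
  by apply: leq_ltn_trans n2; rewrite cards2; case: (_ != _).
by case/card_gt0P => e; rewrite !inE negb_or => /andP[]; exists e.
Qed.

Lemma choice6 (I J T : Type) (P : I -> I -> I -> J -> J -> J -> T -> Prop) :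
  (forall a b c i j k, exists x, P a b c i j k x) ->
  exists f, forall a b c i j k, P a b c i j k (f a b c i j k).
Proof.
move=> eP.
have /choice[f fP] : forall s : I * I * I * (J * J * J), exists x,
    P s.1.1.1 s.1.1.2 s.1.2 s.2.1.1 s.2.1.2 s.2.2 x by move=> s; exact: eP.
by exists (fun a b c i j k => f ((a, b, c), (i, j, k))) => a b c i j k;
  exact: (fP ((a, b, c), (i, j, k))).
Qed.

Theorem theorem4p3 (R : realType) (p q : nat) (hp : (2 <= p)%N)
    (hq : (2 <= q)%N) :
  ((2 < p)%N ->
   exists F : 'I_p -> 'I_p -> 'I_p -> 'I_q -> 'I_q -> 'I_q ->
              formula p q (comp_ab2 p q),
   forall (M : manifold R (p * q)) (G : ag_structure M) (S : ag_bundle G)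
     (D : comp_ab2 p q -> 'I_p -> 'I_q -> S -> R),
   (forall v, pfaffian (val_ab2 S v) (D v)) ->
   forall (u : S) alpha beta gamma i j k,
     tc S alpha beta gamma i j k u
     = feval (fun v => val_ab2 S v u) (fun v eps m => D v eps m u)
             (F alpha beta gamma i j k))
  /\
  ((2 < q)%N ->
   exists F : 'I_p -> 'I_p -> 'I_p -> 'I_q -> 'I_q -> 'I_q ->
              formula p q (comp_ab1 p q),
   forall (M : manifold R (p * q)) (G : ag_structure M) (S : ag_bundle G)
     (D : comp_ab1 p q -> 'I_p -> 'I_q -> S -> R),
   (forall v, pfaffian (val_ab1 S v) (D v)) ->
   forall (u : S) alpha beta gamma i j k,
     tc S alpha beta gamma i j k u
     = feval (fun v => val_ab1 S v u) (fun v eps m => D v eps m u)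
             (F alpha beta gamma i j k)).
Proof.
split=> [p2|q2].
  suff /choice6[F FP] : forall alpha beta gamma i j k,
      exists F : formula p q (comp_ab2 p q),
      forall (M : manifold R (p * q)) (G : ag_structure M) (S : ag_bundle G)
        (D : comp_ab2 p q -> 'I_p -> 'I_q -> S -> R),
      (forall v, pfaffian (val_ab2 S v) (D v)) -> forall u : S,
      tc S alpha beta gamma i j k u
      = feval (fun v => val_ab2 S v u) (fun v eps m => D v eps m u) F.
    by exists F => M G S D dD u alpha beta gamma i j k; exact: FP.
  move=> alpha beta gamma i j k.
  have [eps [eb eg]] := exists_ord_avoiding beta gamma p2.
  have [F FE] : expressible (fun val der =>
      ratr ((p + q)%:R / (2 * q * p)%:R) * bianchi_cycle
        (fun s t => val (B2 alpha s.1 t.1 eps s.2 t.2))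
        (fun s t r => der (B2 alpha s.1 t.1 eps s.2 t.2) r.1 r.2)
        (fun r x y => val (A2 r.2 x.1 y.1 r.1 x.2 y.2))
        (eps, i) (beta, j) (gamma, k) : R).
    apply/expressibleZ/expressible_cycle => *; do ?exact: expressible_comp.
    exact: expressible_pfaffian.
  exists F => M G S D dD u; rewrite -FE fmorph_div !rmorph_nat.
  apply: (tc_from_tb2
    (D := fun b1 b2 b3 b4 k l => D (B2 b1 b2 b3 b4 k l))) => //.
  by move=> b1 b2 b3 b4 k' l; exact: (dD (B2 b1 b2 b3 b4 k' l)).
suff /choice6[F FP] : forall alpha beta gamma i j k,
    exists F : formula p q (comp_ab1 p q),
    forall (M : manifold R (p * q)) (G : ag_structure M) (S : ag_bundle G)
      (D : comp_ab1 p q -> 'I_p -> 'I_q -> S -> R),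
    (forall v, pfaffian (val_ab1 S v) (D v)) -> forall u : S,
    tc S alpha beta gamma i j k u
    = feval (fun v => val_ab1 S v u) (fun v eps m => D v eps m u) F.
  by exists F => M G S D dD u alpha beta gamma i j k; exact: FP.
move=> alpha beta gamma i j k.
have [m [mj mk]] := exists_ord_avoiding j k q2.
have [F FE] : expressible (fun val der =>
    ratr (- ((p + q)%:R / (2 * p * q)%:R)) * bianchi_cycle
      (fun s t => val (B1 m s.1 t.1 i s.2 t.2))
      (fun s t r => der (B1 m s.1 t.1 i s.2 t.2) r.1 r.2)
      (fun r x y => val (A1 r.2 x.1 y.1 r.1 x.2 y.2))
      (alpha, m) (beta, j) (gamma, k) : R).
  apply/expressibleZ/expressible_cycle => *; do ?exact: expressible_comp.
  exact: expressible_pfaffian.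
exists F => M G S D dD u; rewrite -FE rmorphN fmorph_div !rmorph_nat.
apply: (tc_from_tb1 (D := fun j1 g d j2 k l => D (B1 j1 g d j2 k l))) => //.
by move=> j1 g d j2 k' l; exact: (dD (B1 j1 g d j2 k' l)).
Qed.
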